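(* Let $\beta=1-\delta$ where $\delta=\delta(n)>0$ satisfies $\delta^2n\to\infty$. Then the normalized magnetization chain $(S_t)$ of the Glauber dynamics for the mean-field Ising model on $n$ vertices exhibits cutoff at time $\frac12\cdot\frac n\delta\log(\delta^2n)$ with a window of order $n/\delta$; that is, $$\lim_{\gamma\to\infty}\limsup_{n\to\infty} d_n\Big(\tfrac12\tfrac n\delta\log(\delta^2n)+\gamma\tfrac n\delta\Big)=0\quad\text{and}\quad \lim_{\gamma\to\infty}\liminf_{n\to\infty} d_n\Big(\tfrac12\tfrac n\delta\log(\delta^2n)-\gamma\tfrac n\delta\Big)=1,$$ where $d_n(t)=\max_{s_0}\|\mathbb{P}_{s_0}(S_t\in\cdot)-\pi_n\|_{\mathrm{TV}}$.
   Context: For $n\ge1$ and $\beta\ge0$, the mean-field Ising measure on $\Omega=\{1,-1\}^n$ is $\mu_n(\sigma)\propto\exp\big(\frac{\beta}{n}\sum_{x<y}\sigma(x)\sigma(y)\big)$; the heat-bath Glauber dynamics chooses a uniform vertex and resamples its spin from $\mu_n$ conditioned on the other spins. The normalized magnetization $S(\sigma)=\frac1n\sum_i\sigma(i)$ evolves as a Markov chain $S_t$ on $\{-1,-1+\frac2n,\dots,1\}$ with $P(s,s-\frac2n)=\frac{1+s}{2}\cdot\frac{1-\tanh(\beta(s-1/n))}{2}$, $P(s,s+\frac2n)=\frac{1-s}{2}\cdot\frac{1+\tanh(\beta(s+1/n))}{2}$, and remaining mass on $P(s,s)$; $\pi_n$ denotes its stationary distribution (the law of $S$ under $\mu_n$);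 the maximum in $d_n$ is over all starting states $s_0$ of the chain. *)

(* Defs.v *)
From Stdlib Require Import Reals List Arith ZArith.
From Coquelicot Require Import Coquelicot.
Import ListNotations.
Open Scope R_scope.

Fixpoint configs (n : nat) : list (list bool) :=
  match n with
  | O => [[]]
  | S m => map (cons true) (configs m) ++ map (cons false) (configs m)
  end.

Definition spin (b : bool) : R := if b then 1 else -1.

Definition sum_list (l : list R) : R := fold_right Rplus 0 l.

Fixpoint pair_sum (sigma : list bool) : R :=
  match sigma with
  | [] => 0
  | b :: r => spin b * sum_list (map spin r) + pair_sum r
  end.

Definition ising_weight (n : nat) (beta : R) (sigma : list bool) : R :=
  exp (beta / INR n * pair_sum sigma).

Definition partition_fn (n : nat) (beta : R) : R :=
  sum_list (map (ising_weight n beta) (configs n)).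

Definition mu (n : nat) (beta : R) (sigma : list bool) : R :=
  ising_weight n beta sigma / partition_fn n beta.

(* State k in {0,...,n} stands for the magnetization value s_k = -1 + 2k/n
   (k = number of + spins). *)
Definition mag (n k : nat) : R := -1 + 2 * INR k / INR n.

(* pi_n : the law of S(sigma) = (1/n) sum_i sigma(i) under mu_n;
   S(sigma) = mag n k iff sigma has exactly k plus spins. *)
Definition pi_n (n : nat) (beta : R) (k : nat) : R :=
  sum_list (map (mu n beta)
    (filter (fun sigma => Nat.eqb (count_occ Bool.bool_dec sigma true) k) (configs n))).

Definition p_down (n : nat) (beta : R) (k : nat) : R :=
  (1 + mag n k) / 2 * ((1 - tanh (beta * (mag n k - / INR n))) / 2).

Definition p_up (n : nat) (beta : R) (k : nat) : R :=
  (1 - mag n k) / 2 * ((1 + tanh (beta * (mag n k + / INR n))) / 2).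

Definition P_mag (n : nat) (beta : R) (i j : nat) : R :=
  (if Nat.eqb (S j) i then p_down n beta i else 0)
  + (if Nat.eqb j (S i) then p_up n beta i else 0)
  + (if Nat.eqb j i then 1 - p_down n beta i - p_up n beta i else 0).

Fixpoint dist_t (n : nat) (beta : R) (k0 : nat) (t : nat) (j : nat) : R :=
  match t with
  | O => if Nat.eqb j k0 then 1 else 0
  | S t' => sum_f_R0 (fun i => dist_t n beta k0 t' i * P_mag n beta i j) n
  end.

Definition tv_dist (n : nat) (beta : R) (k0 t : nat) : R :=
  / 2 * sum_f_R0 (fun j => Rabs (dist_t n beta k0 t j - pi_n n beta j)) n.

Definition d_n (n : nat) (beta : R) (t : nat) : R :=
  fold_right Rmax 0 (map (fun k0 => tv_dist n beta k0 t) (seq 0 (S n))).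

(* d_n at a real time t: evaluated at floor(t) (0 for negative t). *)
Definition d_n_real (n : nat) (beta : R) (t : R) : R :=
  d_n n beta (Z.to_nat (Int_part t)).

Definition Rbar_lim_at_infty (f : R -> Rbar) (l : R) : Prop :=
  forall eps : R, 0 < eps -> exists G : R, forall g : R, G < g ->
    Rbar_lt (Finite (l - eps)) (f g) /\ Rbar_lt (f g) (Finite (l + eps)).

(* Main.v *)
(** Write [P] for the transition operator acting on functions of the number of plus
    spins, [Lip f] for the largest increment of [f] over neighbouring states, and [s] for
    the magnetization.  Since [tanh] is 1-Lipschitz, [P] contracts: [Lip (P f) <= (1 - delta/n) Lip f].

    Upper bound.  Split the time into three stretches.  During the first [n/delta] steps the
    cubic drift of order [s^3/n] brings [E s^2] down to [O(delta)] from any start; during the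
    last [n/delta] steps a coupling of two chains turns a bounded test function [f] into one
    with [Lip = O(sqrt (delta/n))]; in between, the contraction gains
    [(1 - delta/n)^tau <= exp (O(1) - gamma) / (delta sqrt n)].  The product of the distance
    [n sqrt delta] and these two factors is [O(exp (- gamma))], uniformly over the starting
    state, hence also against the stationary law.

    Lower bound.  Contraction bounds the variance of [s] at every time by [4/(delta n)], and the
    stationary second moment is [O(1/(delta n))].  The operator [P] preserves odd functions that are
    nonnegative for [s >= 0], and the odd function [s - s^3/delta] decays at a rate at most
    [(1 + o(1)) delta/n]; so from [s_0] of order [sqrt delta] the mean of [s] at the time considered
    is still at least of order [exp gamma / sqrt (delta n)], and Chebyshev's inequality separates
    the two laws. *)
Require Import Defs.
From Stdlib Require Import Reals Lra Lia List Psatz ZArith.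
From Coquelicot Require Import Coquelicot.
Import ListNotations.
Open Scope R_scope.

(** * Hyperbolic tangent *)

Lemma nondecreasing_of_derive (f df : R -> R) (a b : R) :
  a <= b -> (forall x, a <= x <= b -> is_derive f x (df x)) ->
  (forall x, a <= x <= b -> 0 <= df x) -> f a <= f b.
Proof.
  intros Hab Hd Hpos.
  destruct (MVT_gen f a b df) as [c [Hc Heq]].
  - rewrite Rmin_left, Rmax_right by lra. intros x Hx. apply Hd. lra.
  - rewrite Rmin_left, Rmax_right by lra. intros x Hx.
    apply continuity_pt_filterlim, (ex_derive_continuous f).
    exists (df x). now apply Hd.
  - rewrite Rmin_left, Rmax_right in Hc by lra.
    assert (0 <= df c * (b - a)) by (apply Rmult_le_pos; [now apply Hpos | lra]).
    lra.
Qed.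

Lemma cosh_pos (x : R) : 0 < cosh x.
Proof. unfold cosh. pose proof (exp_pos x). pose proof (exp_pos (- x)). lra. Qed.

Lemma tanh_opp (x : R) : tanh (- x) = - tanh x.
Proof.
  unfold tanh. replace (cosh (- x)) with (cosh x).
  - replace (sinh (- x)) with (- sinh x).
    + unfold Rdiv. ring.
    + unfold sinh. rewrite Ropp_involutive. field.
  - unfold cosh. rewrite Ropp_involutive. field.
Qed.

Lemma tanh_0 : tanh 0 = 0.
Proof. pose proof (tanh_opp 0) as H. rewrite Ropp_0 in H. lra. Qed.

Lemma cosh_sq (x : R) : cosh x * cosh x = 1 + sinh x * sinh x.
Proof.
  assert (H : exp x * exp (- x) = 1) by (rewrite <- exp_plus, Rplus_opp_r; apply exp_0).
  unfold cosh, sinh. nra.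
Qed.

Lemma is_derive_tanh (x : R) : is_derive tanh x (1 - tanh x * tanh x).
Proof.
  pose proof (cosh_pos x) as Hc.
  apply is_derive_ext with (f := fun y => sinh y / cosh y); [reflexivity |].
  replace (1 - tanh x * tanh x)
    with ((cosh x * cosh x - sinh x * sinh x) / (cosh x) ^ 2).
  - apply (is_derive_div sinh cosh x (cosh x) (sinh x)).
    + apply is_derive_Reals, derivable_pt_lim_sinh.
    + apply is_derive_Reals, derivable_pt_lim_cosh.
    + lra.
  - unfold tanh. field. lra.
Qed.

Lemma tanh_sq_lt_1 (x : R) : tanh x * tanh x < 1.
Proof.
  pose proof (cosh_pos x) as Hc. pose proof (cosh_sq x) as Hs.
  assert (H : tanh x * tanh x = 1 - / (cosh x * cosh x)).
  { unfold tanh. replace (sinh x / cosh x * (sinh x / cosh x))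
      with ((sinh x * sinh x) / (cosh x * cosh x)) by (field; lra).
    replace (sinh x * sinh x) with (cosh x * cosh x - 1) by lra. field. lra. }
  assert (0 < / (cosh x * cosh x)) by (apply Rinv_0_lt_compat; nra). lra.
Qed.

Lemma tanh_bound (x : R) : -1 < tanh x < 1.
Proof. pose proof (tanh_sq_lt_1 x). split; nra. Qed.

Lemma tanh_incr (x y : R) : x <= y -> tanh x <= tanh y.
Proof.
  intro H. apply (nondecreasing_of_derive _ (fun z => 1 - tanh z * tanh z)); auto.
  - intros z _. apply is_derive_tanh.
  - intros z _. pose proof (tanh_sq_lt_1 z). lra.
Qed.

Lemma tanh_lipschitz (x y : R) : x <= y -> tanh y - tanh x <= y - x.
Proof.
  intro H.
  assert (x - tanh x <= y - tanh y); [| lra].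
  apply (nondecreasing_of_derive (fun z => z - tanh z) (fun z => tanh z * tanh z)); auto.
  - intros z _. evar_last.
    + apply (is_derive_minus (fun u => u) tanh z 1 (1 - tanh z * tanh z)).
      * apply (@is_derive_id R_AbsRing).
      * apply is_derive_tanh.
    + unfold minus, plus, opp; simpl. ring.
  - intros z _. nra.
Qed.

Lemma tanh_le_id (x : R) : 0 <= x -> 0 <= tanh x <= x.
Proof.
  intro H. pose proof (tanh_incr 0 x H). pose proof (tanh_lipschitz 0 x H).
  rewrite tanh_0 in *. lra.
Qed.

Lemma tanh_ge_cubic (x : R) : 0 <= x -> x - x ^ 3 / 3 <= tanh x.
Proof.
  intro H.
  assert (tanh 0 - 0 + 0 ^ 3 / 3 <= tanh x - x + x ^ 3 / 3);
    [| rewrite tanh_0 in *; simpl in *; lra].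
  apply (nondecreasing_of_derive (fun z => tanh z - z + z ^ 3 / 3)
           (fun z => z * z - tanh z * tanh z)); auto.
  - intros z _. evar_last.
    + apply (is_derive_plus (fun u => tanh u - u) (fun u => u ^ 3 / 3) z
               (1 - tanh z * tanh z - 1) (z * z)).
      * apply (is_derive_minus tanh (fun u => u)).
        -- apply is_derive_tanh.
        -- apply (@is_derive_id R_AbsRing).
      * auto_derive; [trivial | field].
    + unfold minus, plus, opp; simpl. ring.
  - intros z Hz. pose proof (tanh_le_id z (proj1 Hz)). nra.
Qed.

(** Differentiating reduces the claim to [tanh z ^ 2 >= z ^ 2 / 3]; the lower cubic bound gives
    [tanh z >= 2/3 z] on [[0,1]], and 4/9 exceeds 1/3. *)
Lemma tanh_le_cubic (x : R) : 0 <= x <= 1 -> tanh x <= x - x ^ 3 / 9.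
Proof.
  intro H.
  assert (0 - tanh 0 - 0 ^ 3 / 9 <= x - tanh x - x ^ 3 / 9);
    [| rewrite tanh_0 in *; simpl in *; lra].
  apply (nondecreasing_of_derive (fun z => z - tanh z - z ^ 3 / 9)
           (fun z => tanh z * tanh z - z * z / 3)); [lra | |].
  - intros z _. evar_last.
    + apply (is_derive_minus (fun u => u - tanh u) (fun u => u ^ 3 / 9) z
               (1 - (1 - tanh z * tanh z)) (z * z / 3)).
      * apply (is_derive_minus (fun u => u) tanh).
        -- apply (@is_derive_id R_AbsRing).
        -- apply is_derive_tanh.
      * auto_derive; [trivial | field].
    + unfold minus, plus, opp; simpl. ring.
  - intros z Hz. pose proof (tanh_ge_cubic z (proj1 Hz)).
    assert (2 / 3 * z <= tanh z) by nra. nra.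
Qed.

Lemma tanh_1_lt : tanh 1 < 9 / 10.
Proof. pose proof (tanh_le_cubic 1). nra. Qed.

(** * The birth-death chain and its transition operator *)

Lemma INR_inv_pos (n : nat) : (0 < n)%nat -> 0 < / INR n.
Proof. intro H. apply Rinv_0_lt_compat, lt_0_INR, H. Qed.

Lemma INR_inv_le_1 (n : nat) : (0 < n)%nat -> / INR n <= 1.
Proof.
  intro H. rewrite <- Rinv_1. apply Rinv_le_contravar; [lra |].
  apply (le_INR 1). lia.
Qed.

Lemma mag_S (n k : nat) : mag n (S k) = mag n k + 2 * / INR n.
Proof. unfold mag. rewrite S_INR. unfold Rdiv. ring. Qed.

Lemma mag_bound (n k : nat) : (0 < n)%nat -> (k <= n)%nat -> -1 <= mag n k <= 1.
Proof.
  intros Hn Hk. unfold mag. apply le_INR in Hk. apply lt_0_INR in Hn.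
  assert (0 <= INR k / INR n <= 1).
  { split; [apply Rdiv_le_0_compat; [apply pos_INR | lra] |].
    apply Rmult_le_reg_r with (INR n); [lra |]. field_simplify; lra. }
  unfold Rdiv in *. lra.
Qed.

Lemma mag_symm (n k : nat) : (0 < n)%nat -> (k <= n)%nat -> mag n (n - k) = - mag n k.
Proof.
  intros Hn Hk. unfold mag. rewrite minus_INR by lia. apply lt_0_INR in Hn. field. lra.
Qed.

Lemma mag_n (n : nat) : (0 < n)%nat -> mag n n = 1.
Proof. intro Hn. unfold mag. apply lt_0_INR in Hn. field. lra. Qed.

Lemma mag_0 (n : nat) : mag n 0 = -1.
Proof. unfold mag. simpl. unfold Rdiv. ring. Qed.

Lemma p_down_0 (n : nat) (b : R) : p_down n b 0 = 0.
Proof. unfold p_down. rewrite mag_0. field. Qed.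

Lemma p_up_n (n : nat) (b : R) : (0 < n)%nat -> p_up n b n = 0.
Proof. intro Hn. unfold p_up. rewrite mag_n by auto. field. Qed.

Lemma p_symm (n k : nat) (b : R) :
  (0 < n)%nat -> (k <= n)%nat ->
  p_up n b (n - k) = p_down n b k /\ p_down n b (n - k) = p_up n b k.
Proof.
  intros Hn Hk. unfold p_up, p_down. rewrite mag_symm by auto.
  replace (b * (- mag n k + / INR n)) with (- (b * (mag n k - / INR n))) by ring.
  replace (b * (- mag n k - / INR n)) with (- (b * (mag n k + / INR n))) by ring.
  rewrite !tanh_opp. split; field.
Qed.

Lemma p_up_nonneg (n k : nat) (b : R) :
  (0 < n)%nat -> (k <= n)%nat -> 0 <= p_up n b k.
Proof.
  intros Hn Hk. unfold p_up. pose proof (mag_bound n k Hn Hk).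
  pose proof (tanh_bound (b * (mag n k + / INR n))). nra.
Qed.

Lemma p_down_nonneg (n k : nat) (b : R) :
  (0 < n)%nat -> (k <= n)%nat -> 0 <= p_down n b k.
Proof.
  intros Hn Hk. unfold p_down. pose proof (mag_bound n k Hn Hk).
  pose proof (tanh_bound (b * (mag n k - / INR n))). nra.
Qed.

(** The tanh argument is at most 1 in [p_down] and at least -1 in [p_up], so each heat-bath factor
    is at least [(1 - tanh 1) / 2 > 1/20], and the weights [(1 + s) / 2], [(1 - s) / 2] sum to 1.
    This randomness drives the smoothing. *)
Lemma move_ge (n k : nat) (b : R) :
  (0 < n)%nat -> (k <= n)%nat -> 0 <= b <= 1 ->
  / 20 <= p_down n b k + p_up n b k.
Proof.
  intros Hn Hk Hb. unfold p_down, p_up. pose proof (mag_bound n k Hn Hk) as Hs.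
  pose proof (INR_inv_pos n Hn) as Hh. pose proof (INR_inv_le_1 n Hn) as Hh1.
  set (s := mag n k) in *. set (h := / INR n) in *.
  assert (H1 : tanh (b * (s - h)) <= tanh 1) by (apply tanh_incr; nra).
  assert (H2 : tanh (- (1)) <= tanh (b * (s + h))) by (apply tanh_incr; nra).
  rewrite tanh_opp in H2. pose proof tanh_1_lt. nra.
Qed.

(** For [b >= 0] resampling favours the majority sign, that is [s tanh (b s) >= 0]; without the
    shifts by [1/n] the chain would thus move with probability at most 1/2, and the shifts cost at
    most [1/n]. *)
Lemma move_le (n k : nat) (b : R) :
  (0 < n)%nat -> (k <= n)%nat -> 0 <= b <= 1 ->
  p_down n b k + p_up n b k <= 1 / 2 + / INR n.
Proof.
  intros Hn Hk Hb. unfold p_down, p_up. pose proof (mag_bound n k Hn Hk) as Hs.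
  pose proof (INR_inv_pos n Hn) as Hh.
  set (s := mag n k) in *. set (h := / INR n) in *.
  assert (Hbh : b * h <= h) by nra.
  assert (H1 : tanh (b * (s + h)) - tanh (b * s) <= b * (s + h) - b * s)
    by (apply tanh_lipschitz; nra).
  assert (H2 : tanh (b * s) - tanh (b * (s - h)) <= b * s - b * (s - h))
    by (apply tanh_lipschitz; nra).
  assert (H3 : tanh (b * (s - h)) <= tanh (b * s)) by (apply tanh_incr; nra).
  assert (H4 : tanh (b * s) <= tanh (b * (s + h))) by (apply tanh_incr; nra).
  assert (H5 : 0 <= s * tanh (b * s)).
  { destruct (Rle_dec 0 s).
    - pose proof (tanh_le_id (b * s)). nra.
    - pose proof (tanh_le_id (b * - s)). replace (b * - s) with (- (b * s)) in * by ring.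
      rewrite tanh_opp in *. nra. }
  nra.
Qed.

(** The two moves use the same tanh, so their heat-bath factors add up to 1. Hence two neighbours
    can be coupled without swapping, which makes the weights in [lip_markov_op] nonnegative. *)
Lemma cross_le_1 (n k : nat) (b : R) :
  (S k <= n)%nat -> p_down n b (S k) + p_up n b k <= 1.
Proof.
  intros Hk. assert (Hn : (0 < n)%nat) by lia.
  unfold p_down, p_up. pose proof (mag_bound n k Hn ltac:(lia)) as Hs.
  pose proof (mag_bound n (S k) Hn Hk) as Hs'.
  replace (mag n (S k) - / INR n) with (mag n k + / INR n) by (rewrite mag_S; ring).
  pose proof (tanh_bound (b * (mag n k + / INR n))). nra.
Qed.

(* The one-step contraction: with [T_j = tanh (b * (s + j / n))], the arguments at [k] and [k+1]
   share [T_1], and four times the weight lost is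
   [4/n - (1+s) (T_1 - T_(-1)) - (1-s-2/n) (T_3 - T_1)]. *)
Lemma drift_step (n k : nat) (d : R) :
  0 < d <= 1 -> (S k <= n)%nat ->
  d / INR n <= (p_down n (1 - d) (S k) - p_up n (1 - d) (S k))
               - (p_down n (1 - d) k - p_up n (1 - d) k).
Proof.
  intros Hd Hk. assert (Hn : (0 < n)%nat) by lia.
  pose proof (mag_bound n k Hn ltac:(lia)) as Hs.
  pose proof (mag_bound n (S k) Hn Hk) as Hs'.
  pose proof (INR_inv_pos n Hn) as Hh.
  unfold p_down, p_up, Rdiv at 1.
  rewrite mag_S in *. set (s := mag n k) in *. set (h := / INR n) in *.
  replace (s + 2 * h - h) with (s + h) by ring.
  replace (s + 2 * h + h) with (s + 3 * h) by ring.
  assert (H1 : tanh ((1 - d) * (s + h)) - tanh ((1 - d) * (s - h)) <= (1 - d) * (2 * h))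
    by (eapply Rle_trans; [apply tanh_lipschitz; nra | nra]).
  assert (H2 : tanh ((1 - d) * (s + 3 * h)) - tanh ((1 - d) * (s + h)) <= (1 - d) * (2 * h))
    by (eapply Rle_trans; [apply tanh_lipschitz; nra | nra]).
  nra.
Qed.

Lemma drift_mono (n x y : nat) (d : R) :
  0 < d <= 1 -> (x <= y <= n)%nat ->
  p_down n (1 - d) x - p_up n (1 - d) x <= p_down n (1 - d) y - p_up n (1 - d) y.
Proof.
  intros Hd [Hxy Hy]. induction Hxy as [| y Hxy IH]; [lra |].
  specialize (IH ltac:(lia)). pose proof (drift_step n y d Hd Hy).
  assert (0 < d / INR n) by (apply Rdiv_lt_0_compat; [lra | apply lt_0_INR; lia]). lra.
Qed.

(** For [k <= n], values of [f] outside the state space carry no weight: [p_down] vanishes at 0,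
    where [pred 0 = 0], and [p_up] vanishes at [n]. *)
Definition markov_op (n : nat) (b : R) (f : nat -> R) (k : nat) : R :=
  p_up n b k * f (S k) + p_down n b k * f (pred k)
  + (1 - p_down n b k - p_up n b k) * f k.

Lemma markov_op_le (n : nat) (b : R) (f g : nat -> R) :
  (2 <= n)%nat -> 0 <= b <= 1 ->
  (forall k, (k <= n)%nat -> f k <= g k) ->
  forall k, (k <= n)%nat -> markov_op n b f k <= markov_op n b g k.
Proof.
  intros Hn Hb Hfg k Hk. unfold markov_op.
  assert (Hn0 : (0 < n)%nat) by lia.
  pose proof (p_up_nonneg n k b Hn0 Hk). pose proof (p_down_nonneg n k b Hn0 Hk).
  pose proof (move_le n k b Hn0 Hk Hb).
  assert (/ INR n <= / 2).
  { apply Rinv_le_contravar; [lra |]. apply (le_INR 2) in Hn. simpl in Hn. lra. }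
  assert (p_up n b k * f (S k) <= p_up n b k * g (S k)).
  { destruct (Nat.eq_dec k n) as [-> | Hkn].
    - rewrite p_up_n by auto. lra.
    - apply Rmult_le_compat_l; [auto | apply Hfg; lia]. }
  assert (p_down n b k * f (pred k) <= p_down n b k * g (pred k))
    by (apply Rmult_le_compat_l; [auto | apply Hfg; lia]).
  assert ((1 - p_down n b k - p_up n b k) * f k <= (1 - p_down n b k - p_up n b k) * g k)
    by (apply Rmult_le_compat_l; [lra | apply Hfg; lia]).
  lra.
Qed.

Lemma markov_op_lin (n : nat) (b a c e : R) (f g : nat -> R) (k : nat) :
  markov_op n b (fun j => a * f j + c * g j + e) k
  = a * markov_op n b f k + c * markov_op n b g k + e.
Proof. unfold markov_op. ring. Qed.

Definition markov_iter (n : nat) (b : R) (t : nat) (f : nat -> R) : nat -> R :=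
  Nat.iter t (markov_op n b) f.

Lemma markov_iter_S (n : nat) (b : R) (t : nat) (f : nat -> R) :
  markov_iter n b (S t) f = markov_iter n b t (markov_op n b f).
Proof. unfold markov_iter. rewrite Nat.iter_succ_r. reflexivity. Qed.

Lemma markov_iter_add (n : nat) (b : R) (t s : nat) (f : nat -> R) :
  markov_iter n b (t + s) f = markov_iter n b t (markov_iter n b s f).
Proof. unfold markov_iter. apply Nat.iter_add. Qed.

Lemma markov_iter_le (n : nat) (b : R) (t : nat) (f g : nat -> R) :
  (2 <= n)%nat -> 0 <= b <= 1 ->
  (forall k, (k <= n)%nat -> f k <= g k) ->
  forall k, (k <= n)%nat -> markov_iter n b t f k <= markov_iter n b t g k.
Proof.
  intros Hn Hb Hfg. induction t as [| t IH]; simpl; auto.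
  apply markov_op_le; auto.
Qed.

Lemma markov_op_ext (n : nat) (b : R) (f g : nat -> R) :
  (forall k, f k = g k) -> forall k, markov_op n b f k = markov_op n b g k.
Proof. intros H k. unfold markov_op. now rewrite !H. Qed.

Lemma markov_iter_lin (n : nat) (b a c e : R) (t : nat) (f g : nat -> R) (k : nat) :
  markov_iter n b t (fun j => a * f j + c * g j + e) k
  = a * markov_iter n b t f k + c * markov_iter n b t g k + e.
Proof.
  revert k. induction t as [| t IH]; intro k; simpl; [reflexivity |].
  rewrite <- markov_op_lin. apply markov_op_ext. exact IH.
Qed.

(** * Lipschitz contraction and variance *)

Lemma INR_ge_8 (n : nat) : (8 <= n)%nat -> 8 <= INR n.
Proof. intro H. apply le_INR in H. simpl in H. lra. Qed.

Lemma INR_inv_le_8 (n : nat) : (8 <= n)%nat -> 0 < / INR n <= / 8.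
Proof.
  intro H. apply INR_ge_8 in H. split; [apply Rinv_0_lt_compat; lra |].
  apply Rinv_le_contravar; lra.
Qed.

Definition lip (n : nat) (l : R) (f : nat -> R) : Prop :=
  forall k, (S k <= n)%nat -> Rabs (f (S k) - f k) <= l.

Lemma lip_dist (n : nat) (l : R) (f : nat -> R) :
  lip n l f -> forall x y, (x <= y <= n)%nat -> Rabs (f y - f x) <= l * (INR y - INR x).
Proof.
  intros Hf x y [Hxy Hy]. induction Hxy as [| y Hxy IH].
  - rewrite !Rminus_diag, Rabs_R0. lra.
  - specialize (IH ltac:(lia)). pose proof (Hf y Hy).
    pose proof (Rabs_triang (f (S y) - f y) (f y - f x)).
    replace (f (S y) - f y + (f y - f x)) with (f (S y) - f x) in * by ring.
    rewrite S_INR. lra.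
Qed.

Lemma contraction_range (n : nat) (d : R) :
  (0 < n)%nat -> 0 < d <= 1 -> 0 <= 1 - d / INR n < 1.
Proof.
  intros Hn Hd. pose proof (INR_inv_le_1 n Hn). pose proof (INR_inv_pos n Hn).
  unfold Rdiv. nra.
Qed.

(** The bound on [v] is asked for only when [p > 0]: a move out of the state space has probability
    0, and nothing is known about [f] there. *)
Lemma Rmult_Rabs_le (p v B : R) :
  0 <= p -> (0 < p -> Rabs v <= B) -> Rabs (p * v) <= p * B.
Proof.
  intros Hp H. rewrite Rabs_mult, (Rabs_right p) by lra.
  destruct (Req_dec p 0) as [-> | Hp0]; [lra |].
  apply Rmult_le_compat_l; [lra | apply H; lra].
Qed.

Lemma p_up_pos_lt (n k : nat) (b : R) :
  (0 < n)%nat -> (k <= n)%nat -> 0 < p_up n b k -> (S k <= n)%nat.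
Proof.
  intros Hn Hk Hp. destruct (Nat.eq_dec k n) as [-> | Hkn]; [| lia].
  rewrite p_up_n in Hp by auto. lra.
Qed.

Lemma p_down_pos_gt (n k : nat) (b : R) : 0 < p_down n b k -> k = S (pred k).
Proof. destruct k; [rewrite p_down_0; lra | reflexivity]. Qed.

(** In the monotone coupling the difference at neighbours combines three increments of [f] with
    nonnegative weights. Their total is 1 minus the gain of [p_down - p_up] from [k] to [k + 1],
    which [drift_step] shows to be at most [1 - d / n]. *)
Lemma lip_markov_op (n : nat) (d l : R) (f : nat -> R) :
  0 < d <= 1 -> lip n l f -> lip n ((1 - d / INR n) * l) (markov_op n (1 - d) f).
Proof.
  intros Hd Hf k Hk. assert (Hn : (0 < n)%nat) by lia.
  assert (Hl : 0 <= l) by (eapply Rle_trans; [apply Rabs_pos | apply (Hf k Hk)]).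
  pose proof (drift_step n k d Hd Hk) as Hstep.
  pose proof (cross_le_1 n k (1 - d) Hk) as Hcross.
  set (b := 1 - d) in *.
  pose proof (p_up_nonneg n (S k) b Hn Hk) as Hu. pose proof (p_down_nonneg n k b Hn ltac:(lia)) as Hdn.
  assert (E1 : Rabs ((1 - p_down n b (S k) - p_up n b k) * (f (S k) - f k))
    <= (1 - p_down n b (S k) - p_up n b k) * l).
  { apply Rmult_Rabs_le; [lra |]. intros _. auto. }
  assert (E2 : Rabs (p_up n b (S k) * (f (S (S k)) - f (S k))) <= p_up n b (S k) * l).
  { apply Rmult_Rabs_le; auto. intro Hp. apply Hf. apply p_up_pos_lt in Hp; lia. }
  assert (E3 : Rabs (p_down n b k * (f k - f (pred k))) <= p_down n b k * l).
  { apply Rmult_Rabs_le; auto. intro Hp. apply p_down_pos_gt in Hp.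
    rewrite Hp at 1. apply Hf. lia. }
  replace (markov_op n b f (S k) - markov_op n b f k) with
    ((1 - p_down n b (S k) - p_up n b k) * (f (S k) - f k)
     + p_up n b (S k) * (f (S (S k)) - f (S k)) + p_down n b k * (f k - f (pred k)))
    by (unfold markov_op; simpl; ring).
  eapply Rle_trans; [apply Rabs_triang |].
  eapply Rle_trans; [apply Rplus_le_compat_r, Rabs_triang |]. nra.
Qed.

Lemma lip_markov_iter (n : nat) (d l : R) (t : nat) (f : nat -> R) :
  0 < d <= 1 -> lip n l f -> lip n ((1 - d / INR n) ^ t * l) (markov_iter n (1 - d) t f).
Proof.
  intros Hd Hf. induction t as [| t IH]; simpl.
  - now rewrite Rmult_1_l.
  - rewrite Rmult_assoc. now apply lip_markov_op.
Qed.

(** A variance is at most the mean square deviation from [g k]; each jump changes [g] by at most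
    [l], and the jump probabilities sum to at most 1. *)
Lemma variance_step (n : nat) (b l : R) (g : nat -> R) (k : nat) :
  (2 <= n)%nat -> 0 <= b <= 1 -> lip n l g -> (k <= n)%nat ->
  markov_op n b (fun j => g j * g j) k - markov_op n b g k * markov_op n b g k <= l * l.
Proof.
  intros Hn Hb Hg Hk. assert (Hn0 : (0 < n)%nat) by lia.
  pose proof (p_up_nonneg n k b Hn0 Hk) as Hu. pose proof (p_down_nonneg n k b Hn0 Hk) as Hdn.
  assert (Hl : 0 <= l) by (eapply Rle_trans; [apply Rabs_pos | apply (Hg 0%nat); lia]).
  assert (Hm : p_down n b k + p_up n b k <= 1).
  { pose proof (move_le n k b Hn0 Hk Hb).
    assert (/ INR n <= / 2).
    { apply Rinv_le_contravar; [lra |]. apply (le_INR 2) in Hn. simpl in Hn. lra. }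
    lra. }
  set (x := g (S k) - g k). set (y := g (pred k) - g k).
  assert (Ex : p_up n b k * (x * x) <= p_up n b k * (l * l)).
  { destruct (Req_dec (p_up n b k) 0) as [-> | H0]; [lra |].
    apply Rmult_le_compat_l; auto.
    assert (H : Rabs x <= l) by (apply Hg, (p_up_pos_lt n k b); auto; lra).
    apply Rabs_le_between in H. nra. }
  assert (Ey : p_down n b k * (y * y) <= p_down n b k * (l * l)).
  { destruct (Req_dec (p_down n b k) 0) as [-> | H0]; [lra |].
    apply Rmult_le_compat_l; auto.
    assert (H : Rabs y <= l).
    { assert (Hp : k = S (pred k)) by (apply (p_down_pos_gt n k b); lra).
      unfold y. rewrite Rabs_minus_sym. rewrite Hp at 1. apply Hg. lia. }
    apply Rabs_le_between in H. nra. }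
  replace (markov_op n b (fun j => g j * g j) k - markov_op n b g k * markov_op n b g k)
    with (p_up n b k * (x * x) + p_down n b k * (y * y)
          - (p_up n b k * x + p_down n b k * y) * (p_up n b k * x + p_down n b k * y))
    by (unfold markov_op, x, y; ring).
  pose proof (Rle_0_sqr (p_up n b k * x + p_down n b k * y)) as Hsq. unfold Rsqr in Hsq.
  nra.
Qed.

(** Law of total variance, conditioning on the first step: the remaining [t] steps contribute at
    most [V] by induction, and the first step contributes the variance of [F], whose Lipschitz
    constant is [(1 - d/n)^t l]. The bound is the resulting geometric sum. *)
Lemma variance_iter (n : nat) (d l : R) (f : nat -> R) (t k : nat) :
  (2 <= n)%nat -> 0 < d <= 1 -> lip n l f -> (k <= n)%nat ->
  markov_iter n (1 - d) t (fun j => f j * f j) k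
    - markov_iter n (1 - d) t f k * markov_iter n (1 - d) t f k
  <= l * l * (INR n / d) * (1 - (1 - d / INR n) ^ t).
Proof.
  intros Hn Hd Hf. revert k.
  assert (HN : 0 < INR n) by (apply lt_0_INR; lia).
  induction t as [| t IH]; intros k Hk; simpl.
  - lra.
  - set (F := markov_iter n (1 - d) t f) in *.
    set (V := l * l * (INR n / d) * (1 - (1 - d / INR n) ^ t)) in *.
    assert (Hb : 0 <= 1 - d <= 1) by (split; lra).
    pose proof (variance_step n (1 - d) _ F k Hn Hb
      (lip_markov_iter n d l t f Hd Hf) Hk) as Hone.
    assert (Hle : markov_op n (1 - d) (markov_iter n (1 - d) t (fun j => f j * f j)) k
       <= markov_op n (1 - d) (fun j => 1 * (F j * F j) + 0 * 0 + V) k).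
    { apply markov_op_le; auto. intros j Hj. specialize (IH j Hj). lra. }
    rewrite (markov_op_lin n (1 - d) 1 0 V (fun j => F j * F j) (fun _ => 0)) in Hle.
    change (Nat.iter t (markov_op n (1 - d)) f) with F.
    pose proof (contraction_range n d ltac:(lia) Hd) as Hq.
    replace (l * l * (INR n / d) * (1 - (1 - d / INR n) * (1 - d / INR n) ^ t))
      with (V + l * l * (1 - d / INR n) ^ t) by (unfold V; field; lra).
    set (q := (1 - d / INR n) ^ t) in *.
    assert (Hqt : 0 <= q <= 1).
    { split; [apply pow_le; lra |]. rewrite <- (pow1 t). apply pow_incr. lra. }
    (* Weakening [q^2] to [q] keeps the sum geometric with the ratio [1 - d/n] of the statement. *)
    assert (Hql : q * l * (q * l) <= l * l * q).
    { replace (q * l * (q * l)) with (l * l * (q * q)) by ring.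
      apply Rmult_le_compat_l; [apply Rle_0_sqr | nra]. }
    lra.
Qed.

(** * Smoothing by coupling *)

Lemma p_up_down_bounds (n k : nat) (b : R) :
  (8 <= n)%nat -> (k <= n)%nat -> 0 <= b <= 1 ->
  0 <= p_up n b k /\ 0 <= p_down n b k /\
  / 20 <= p_down n b k + p_up n b k <= 5 / 8.
Proof.
  intros Hn Hk Hb. assert (Hn0 : (0 < n)%nat) by lia.
  pose proof (INR_inv_le_8 n Hn). pose proof (move_le n k b Hn0 Hk Hb).
  pose proof (move_ge n k b Hn0 Hk Hb).
  repeat split; [now apply p_up_nonneg | now apply p_down_nonneg | lra | lra].
Qed.

Lemma Rmult3_Rabs_le (p q v B : R) :
  0 <= p -> 0 <= q -> (0 < p -> 0 < q -> Rabs v <= B) -> Rabs (p * q * v) <= p * q * B.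
Proof.
  intros Hp Hq H. apply Rmult_Rabs_le; [nra |]. intro Hpq. apply H; nra.
Qed.

Lemma Rabs_sum9 (a b c d e f g h i : R) :
  Rabs (a + b + c + d + e + f + g + h + i) <=
  Rabs a + Rabs b + Rabs c + Rabs d + Rabs e + Rabs f + Rabs g + Rabs h + Rabs i.
Proof.
  do 7 (eapply Rle_trans; [apply Rabs_triang |]; apply Rplus_le_compat_r).
  apply Rabs_triang.
Qed.

(* A pair at distance [w], moved independently, drifts together.  The concave term
   [- C w^2] gains the variance; the jump [4 L] of the bound at [w = 0] absorbs the
   crossings that are possible from [w = 1]. *)
Definition pair_bound (L C e w : R) : R := L * (w + 4) - C * (w * w) + e.

(** With [D] the mean and [Q] the mean square of the change of [w], the expected bound is
    [B w + (L - 2 C w) D - C Q]. Monotone drift gives [D <= 0], and the condition on [L] makes its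
    coefficient nonnegative. *)
Lemma independent_step (ux dx uy dy L C e w : R) :
  0 <= ux -> 0 <= dx -> 0 <= uy -> 0 <= dy ->
  / 20 <= dx + ux <= 5 / 8 -> / 20 <= dy + uy <= 5 / 8 ->
  dx - ux <= dy - uy -> 0 <= C -> 2 * C * w <= L ->
  let hx := 1 - dx - ux in
  let hy := 1 - dy - uy in
  let B := pair_bound L C e in
  uy * ux * B w + uy * dx * B (w + 2) + uy * hx * B (w + 1)
  + dy * ux * B (w - 2) + dy * dx * B w + dy * hx * B (w - 1)
  + hy * ux * B (w - 1) + hy * dx * B (w + 1) + hy * hx * B w
  <= B w - C / 40.
Proof.
  intros Hux Hdx Huy Hdy Hmx Hmy Hdr HC HL hx hy B.
  set (D := (uy - dy) - (ux - dx)).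
  set (Q := (dx + ux) + (dy + uy) - 2 * (uy - dy) * (ux - dx)).
  (* [Q] is at least [m_x (1 - m_y) + m_y (1 - m_x)] for the moving probabilities [m_x], [m_y] in
     [[1/20, 5/8]], hence at least 3/80. *)
  assert (HQ : / 40 <= Q).
  { unfold Q. assert ((uy - dy) * (ux - dx) <= (dx + ux) * (dy + uy)) by nra. nra. }
  replace (uy * ux * B w + uy * dx * B (w + 2) + uy * hx * B (w + 1)
  + dy * ux * B (w - 2) + dy * dx * B w + dy * hx * B (w - 1)
  + hy * ux * B (w - 1) + hy * dx * B (w + 1) + hy * hx * B w)
  with (B w + (L - 2 * C * w) * D - C * Q) by (unfold B, pair_bound, D, Q, hx, hy; ring).
  assert (D <= 0) by (unfold D; lra).
  assert ((L - 2 * C * w) * D <= 0) by nra.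
  assert (C * / 40 <= C * Q) by (apply Rmult_le_compat_l; lra).
  lra.
Qed.

Lemma pair_decomposition (n : nat) (b : R) (g : nat -> R) (x y : nat) :
  let ux := p_up n b x in let dx := p_down n b x in let hx := 1 - dx - ux in
  let uy := p_up n b y in let dy := p_down n b y in let hy := 1 - dy - uy in
  markov_op n b g y - markov_op n b g x =
  uy * ux * (g (S y) - g (S x)) + uy * dx * (g (S y) - g (pred x))
  + uy * hx * (g (S y) - g x)
  + dy * ux * (g (pred y) - g (S x)) + dy * dx * (g (pred y) - g (pred x))
  + dy * hx * (g (pred y) - g x)
  + hy * ux * (g y - g (S x)) + hy * dx * (g y - g (pred x)) + hy * hx * (g y - g x).
Proof. cbv zeta. unfold markov_op. ring. Qed.

(** A joint move changes the distance by at most 2, so bounds up to [2 K] suffice for pairs closer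
    than [K]. Only neighbours can cross; all other pairs stay ordered or meet, and
    [independent_step] applies directly. *)
Lemma pair_step (n : nat) (d L C e K : R) (g : nat -> R) :
  (8 <= n)%nat -> 0 < d <= 1 -> 0 <= C -> 0 <= e -> 2 * C * K <= L -> 2 <= K ->
  (forall x y, (x < y <= n)%nat -> INR y - INR x <= 2 * K ->
     Rabs (g y - g x) <= pair_bound L C e (INR y - INR x)) ->
  forall x y, (x < y <= n)%nat -> INR y - INR x < K ->
    Rabs (markov_op n (1 - d) g y - markov_op n (1 - d) g x)
    <= pair_bound L C e (INR y - INR x) - C / 40.
Proof.
  intros Hn Hd HC He HL HK Hg x y [Hxy Hy] Hw.
  assert (Hn0 : (0 < n)%nat) by lia. assert (Hb : 0 <= 1 - d <= 1) by (split; lra).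
  destruct (p_up_down_bounds n x (1 - d) Hn ltac:(lia) Hb) as (Hux & Hdx & Hmx).
  destruct (p_up_down_bounds n y (1 - d) Hn Hy Hb) as (Huy & Hdy & Hmy).
  pose proof (drift_mono n x y d Hd ltac:(lia)) as Hdr.
  pose proof (pair_decomposition n (1 - d) g x y) as Hdec. cbv zeta in Hdec.
  rewrite Hdec. clear Hdec.
  pose proof (p_up_pos_lt n y (1 - d) Hn0 Hy) as Pu.
  pose proof (p_down_pos_gt n x (1 - d)) as Pd.
  set (b := 1 - d) in *.
  set (ux := p_up n b x) in *. set (dx := p_down n b x) in *.
  set (uy := p_up n b y) in *. set (dy := p_down n b y) in *.
  set (w := INR y - INR x) in *.
  assert (HLw : 2 * C * w <= L) by nra.
  assert (HL0 : 0 <= L) by nra.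
  pose proof (independent_step ux dx uy dy L C e w Hux Hdx Huy Hdy Hmx Hmy Hdr HC HLw) as Hind.
  cbv zeta in Hind.
  assert (Hx1 : INR (S x) = INR x + 1) by apply S_INR.
  assert (Hy1 : INR (S y) = INR y + 1) by apply S_INR.
  assert (Hpy : y = S (pred y)) by lia.
  assert (Hy0 : INR (pred y) = INR y - 1) by (rewrite Hpy at 2; rewrite S_INR; ring).
  assert (Hx0 : 0 < dx -> INR (pred x) = INR x - 1).
  { intro H. rewrite (Pd H) at 2. rewrite S_INR. ring. }
  assert (G : forall i j v, (i < j <= n)%nat -> INR j - INR i = v -> v <= 2 * K ->
     Rabs (g j - g i) <= pair_bound L C e v).
  { intros i j v Hij <- Hv. now apply Hg. }
  eapply Rle_trans; [apply Rabs_sum9 |].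
  set (B := pair_bound L C e) in *.
  assert (E1 : Rabs (uy * ux * (g (S y) - g (S x))) <= uy * ux * B w).
  { apply Rmult3_Rabs_le; auto. intros H1 H2. apply G; [specialize (Pu H1); lia | | lra].
    rewrite Hx1, Hy1. unfold w. ring. }
  assert (E2 : Rabs (uy * dx * (g (S y) - g (pred x))) <= uy * dx * B (w + 2)).
  { apply Rmult3_Rabs_le; auto. intros H1 H2. apply G; [specialize (Pu H1); lia | | lra].
    rewrite (Hx0 H2), Hy1. unfold w. ring. }
  assert (E3 : Rabs (uy * (1 - dx - ux) * (g (S y) - g x)) <= uy * (1 - dx - ux) * B (w + 1)).
  { apply Rmult3_Rabs_le; [auto | lra |]. intros H1 H2.
    apply G; [specialize (Pu H1); lia | | lra]. rewrite Hy1. unfold w. ring. }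
  assert (E5 : Rabs (dy * dx * (g (pred y) - g (pred x))) <= dy * dx * B w).
  { apply Rmult3_Rabs_le; auto. intros H1 H2. apply G; [specialize (Pd H2); lia | | lra].
    rewrite (Hx0 H2), Hy0. unfold w. ring. }
  assert (E8 : Rabs ((1 - dy - uy) * dx * (g y - g (pred x))) <= (1 - dy - uy) * dx * B (w + 1)).
  { apply Rmult3_Rabs_le; [lra | auto |]. intros H1 H2.
    apply G; [specialize (Pd H2); lia | | lra]. rewrite (Hx0 H2). unfold w. ring. }
  assert (E9 : Rabs ((1 - dy - uy) * (1 - dx - ux) * (g y - g x))
               <= (1 - dy - uy) * (1 - dx - ux) * B w).
  { apply Rmult3_Rabs_le; [lra | lra |]. intros _ _. apply G; [lia | reflexivity | lra]. }
  destruct (Nat.eq_dec y (S x)) as [Heq | Hne].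
  (* For neighbours a swap ends at distance 1 rather than -1, which costs [2 L]. Meeting makes the
     true difference 0 while the bound at 0 is at least [4 L]; this surplus pays, since
     [ux <= 2 (1 - dx - ux)]. *)
  - assert (Hw1 : w = 1) by (unfold w; rewrite Heq, S_INR; ring).
    assert (Hp : pred y = x) by lia. rewrite Hp, <- Heq in *.
    rewrite !Rminus_diag, !Rmult_0_r, !Rabs_R0.
    assert (E4 : Rabs (dy * ux * (g x - g y)) <= dy * ux * B 1).
    { apply Rmult3_Rabs_le; auto. intros _ _. rewrite Rabs_minus_sym.
      apply G; [lia | unfold w in Hw1; lra | lra]. }
    assert (HB1 : B 1 = B (w - 2) + 2 * L) by (rewrite Hw1; unfold B, pair_bound; ring).
    assert (HB0 : 4 * L <= B (w - 1)) by (rewrite Hw1; unfold B, pair_bound; lra).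
    assert (H4 : dy * ux * (2 * L) <= (dy * (1 - dx - ux) + (1 - dy - uy) * ux) * (4 * L)).
    { assert (dy * ux * 2 <= (dy * (1 - dx - ux) + (1 - dy - uy) * ux) * 4) by nra. nra. }
    assert (H5 : (dy * (1 - dx - ux) + (1 - dy - uy) * ux) * (4 * L)
                 <= (dy * (1 - dx - ux) + (1 - dy - uy) * ux) * B (w - 1)).
    { apply Rmult_le_compat_l; [nra | auto]. }
    rewrite HB1 in E4. rewrite ?Hp, <- ?Heq in *. lra.
  - assert (Hpos : forall i j v, (i <= j <= n)%nat -> INR j - INR i = v -> v <= 2 * K ->
       0 <= v -> Rabs (g j - g i) <= B v).
    { intros i j v Hij Hv HvK Hv0. destruct (Nat.eq_dec i j) as [-> | Hij'].
      - rewrite Rminus_diag in *. rewrite Rabs_R0. subst v. unfold B, pair_bound. lra.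
      - apply G; [lia | auto | auto]. }
    assert (Hw2 : 2 <= w).
    { assert (H : (S (S x) <= y)%nat) by lia. apply le_INR in H. rewrite !S_INR in H.
      unfold w. lra. }
    assert (E4 : Rabs (dy * ux * (g (pred y) - g (S x))) <= dy * ux * B (w - 2)).
    { apply Rmult3_Rabs_le; auto. intros _ _. apply Hpos; [lia | | lra | lra].
      rewrite Hy0, Hx1. unfold w. ring. }
    assert (E6 : Rabs (dy * (1 - dx - ux) * (g (pred y) - g x)) <= dy * (1 - dx - ux) * B (w - 1)).
    { apply Rmult3_Rabs_le; [auto | lra |]. intros _ _. apply Hpos; [lia | | lra | lra].
      rewrite Hy0. unfold w. ring. }
    assert (E7 : Rabs ((1 - dy - uy) * ux * (g y - g (S x))) <= (1 - dy - uy) * ux * B (w - 1)).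
    { apply Rmult3_Rabs_le; [lra | auto |]. intros _ _. apply Hpos; [lia | | lra | lra].
      rewrite Hx1. unfold w. ring. }
    lra.
Qed.

Lemma osc_markov_iter (n : nat) (b : R) (t : nat) (f : nat -> R) :
  (8 <= n)%nat -> 0 <= b <= 1 -> (forall k, (k <= n)%nat -> Rabs (f k) <= / 2) ->
  forall k, (k <= n)%nat -> Rabs (markov_iter n b t f k) <= / 2.
Proof.
  intros Hn Hb Hf k Hk. apply Rabs_le. split.
  - replace (- / 2) with (markov_iter n b t (fun j => 0 * 0 + 0 * 0 + - / 2) k).
    + apply markov_iter_le; auto; [lia |]. intros j Hj.
      specialize (Hf j Hj). apply Rabs_le_between in Hf. lra.
    + rewrite (markov_iter_lin n b 0 0 (- / 2) t (fun _ => 0) (fun _ => 0)). ring.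
  - replace (/ 2) with (markov_iter n b t (fun j => 0 * 0 + 0 * 0 + / 2) k).
    + apply markov_iter_le; auto; [lia |]. intros j Hj.
      specialize (Hf j Hj). apply Rabs_le_between in Hf. lra.
    + rewrite (markov_iter_lin n b 0 0 (/ 2) t (fun _ => 0) (fun _ => 0)). ring.
Qed.

(** The bound [L (w + 4) - C w^2 + e] is carried through [t] steps while [e] falls from 1, where the
    oscillation of [f] alone suffices, to 0. Reading it at [w = 1] gives the Lipschitz constant. *)
Lemma smoothing (n : nat) (d : R) (t : nat) (f : nat -> R) :
  (8 <= n)%nat -> 0 < d <= 1 -> (4 <= t)%nat ->
  (forall k, (k <= n)%nat -> Rabs (f k) <= / 2) ->
  lip n (405 / sqrt (INR t)) (markov_iter n (1 - d) t f).
Proof.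
  intros Hn Hd Ht Hf.
  assert (Ht4 : 4 <= INR t) by (apply le_INR in Ht; simpl in Ht; lra).
  set (K := sqrt (INR t)).
  assert (HKK : K * K = INR t) by (apply sqrt_sqrt; lra).
  assert (HK : 2 <= K).
  { unfold K. replace 2 with (sqrt (2 * 2)) by (apply sqrt_square; lra). apply sqrt_le_1; lra. }
  (* [C / 40 = 1 / t] is the loss per step, so [e] is used up exactly at time [t]. The slope [L]
     exceeds the [2 C K] that [pair_step] requires by [1 / K], which makes the bound at least 1 for
     [K <= w <= 2 K]. *)
  set (C := 40 / INR t). set (L := / K + 2 * C * K).
  assert (HC : 0 < C) by (unfold C; apply Rdiv_lt_0_compat; lra).
  assert (HiK : 0 < / K) by (apply Rinv_0_lt_compat; lra).
  assert (Hosc : forall s x y, (x <= n)%nat -> (y <= n)%nat ->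
     Rabs (markov_iter n (1 - d) s f y - markov_iter n (1 - d) s f x) <= 1).
  { intros s x y Hx Hy. assert (Hb : 0 <= 1 - d <= 1) by (split; lra).
    pose proof (osc_markov_iter n (1 - d) s f Hn Hb Hf x Hx) as H1.
    pose proof (osc_markov_iter n (1 - d) s f Hn Hb Hf y Hy) as H2.
    apply Rabs_le_between in H1. apply Rabs_le_between in H2. apply Rabs_le. lra. }
  assert (Hmain : forall s, (s <= t)%nat -> forall x y, (x < y <= n)%nat ->
    INR y - INR x <= 2 * K ->
    Rabs (markov_iter n (1 - d) s f y - markov_iter n (1 - d) s f x)
    <= pair_bound L C (C / 40 * (INR t - INR s)) (INR y - INR x)).
  { induction s as [| s IH]; intros Hs x y Hxy Hw;
      assert (Hw1 : 1 <= INR y - INR x)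
        by (assert (H : (S x <= y)%nat) by lia; apply le_INR in H; rewrite S_INR in H; lra);
      pose proof (Hosc 0%nat x y ltac:(lia) ltac:(lia)) as Ho.
    - eapply Rle_trans; [apply Ho |]. unfold pair_bound. simpl INR.
      replace (C / 40 * (INR t - 0)) with 1 by (unfold C; field; lra).
      unfold L. set (w := INR y - INR x) in *.
      assert (0 <= C * w * (2 * K - w)) by (apply Rmult_le_pos; nra). nra.
    - specialize (IH ltac:(lia)).
      assert (Hst : INR s + 1 <= INR t) by (apply le_INR in Hs; rewrite S_INR in Hs; lra).
      destruct (Rlt_dec (INR y - INR x) K) as [HwK | HwK].
      + assert (He : 0 <= C / 40 * (INR t - INR s)) by (apply Rmult_le_pos; lra).
        pose proof (pair_step n d L C (C / 40 * (INR t - INR s)) K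
          (markov_iter n (1 - d) s f) Hn Hd ltac:(lra) He ltac:(unfold L; lra) HK IH x y Hxy HwK)
          as Hstep.
        eapply Rle_trans; [apply Hstep |]. unfold pair_bound. rewrite S_INR. lra.
      (* Pairs at distance at least [K] need no coupling: there [w / K >= 1] and
         [C w (2 K - w) >= 0], so the bound dominates the oscillation. *)
      + eapply Rle_trans; [apply Hosc; lia |]. unfold pair_bound, L.
        set (w := INR y - INR x) in *. rewrite S_INR.
        assert (0 <= C * w * (2 * K - w)) by (apply Rmult_le_pos; nra).
        assert (/ K * K <= / K * w) by (apply Rmult_le_compat_l; lra).
        rewrite Rinv_l in * by lra.
        assert (0 <= C / 40 * (INR t - (INR s + 1))) by (apply Rmult_le_pos; lra).
        nra. }
  intros k Hk. eapply Rle_trans; [apply (Hmain t ltac:(lia) k (S k) ltac:(lia)) |].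
  - rewrite S_INR. lra.
  - rewrite S_INR. unfold pair_bound, L, C. rewrite <- HKK.
    replace (INR k + 1 - INR k) with 1 by ring.
    (* At [w = 1], [5 L = 5 / K + 400 / K] because [K^2 = t]. *)
    replace ((/ K + 2 * (40 / (K * K)) * K) * (1 + 4) - 40 / (K * K) * (1 * 1) +
      40 / (K * K) / 40 * (K * K - K * K)) with (405 / K - 40 * (/ K * / K)) by (field; lra).
    nra.
Qed.

(** * Second moments *)

(** At [k = 0] the left side uses [pred 0 = 0] and the right side a point below -1; both carry the
    weight [p_down = 0]. *)
Lemma markov_op_mag (n : nat) (b : R) (F : R -> R) (k : nat) :
  markov_op n b (fun j => F (mag n j)) k =
  p_up n b k * F (mag n k + 2 * / INR n) + p_down n b k * F (mag n k - 2 * / INR n)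
  + (1 - p_down n b k - p_up n b k) * F (mag n k).
Proof.
  unfold markov_op. rewrite mag_S. destruct k as [| k]; simpl pred.
  - rewrite p_down_0. ring.
  - rewrite (mag_S n k). replace (mag n k + 2 * / INR n - 2 * / INR n) with (mag n k) by ring.
    reflexivity.
Qed.

(** By evenness only [s >= 0] matters. The first upper bound keeps [b] and yields linear decay at
    rate [delta]; the second discards [b] and keeps a quartic gain, which acts however small [delta]
    is. *)
Lemma mag_mul_tanh (b s : R) :
  0 <= b <= 1 -> -1 <= s <= 1 ->
  0 <= s * tanh (b * s) /\ s * tanh (b * s) <= b * (s * s) /\
  s * tanh (b * s) <= s * s - s ^ 4 / 9.
Proof.
  intros Hb Hs.
  assert (H : forall u, 0 <= u <= 1 -> 0 <= u * tanh (b * u) /\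
    u * tanh (b * u) <= b * (u * u) /\ u * tanh (b * u) <= u * u - u ^ 4 / 9).
  { intros u Hu. pose proof (tanh_le_id (b * u) ltac:(nra)) as H1.
    assert (H2 : tanh (b * u) <= tanh u) by (apply tanh_incr; nra).
    pose proof (tanh_le_cubic u Hu) as H3.
    repeat split; [nra | nra |]. simpl in *. nra. }
  destruct (Rle_dec 0 s) as [H0 | H0]; [apply H; lra |].
  specialize (H (- s) ltac:(lra)).
  replace (b * - s) with (- (b * s)) in H by ring. rewrite tanh_opp in H.
  replace (- s * - tanh (b * s)) with (s * tanh (b * s)) in H by ring.
  replace (- s * - s) with (s * s) in H by ring.
  replace ((- s) ^ 4) with (s ^ 4) in H by ring. exact H.
Qed.

(** The exact expansion is [s^2 - 4 s (dn - u) / n + 4 (dn + u) / n^2], whose drift is estimated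
    through [s tanh (b s)]. The constant 6 is 4 from the jumps plus 2 from moving the tanh arguments
    by [1/n]. *)
Lemma second_moment_step (n k : nat) (d : R) :
  (8 <= n)%nat -> 0 < d <= 1 -> (k <= n)%nat ->
  let s := mag n k in
  let m := markov_op n (1 - d) (fun j => mag n j * mag n j) k in
  m <= (1 - 2 * d * / INR n) * (s * s) + 6 * (/ INR n * / INR n) /\
  m <= s * s - 2 / 9 * / INR n * s ^ 4 + 6 * (/ INR n * / INR n).
Proof.
  intros Hn Hd Hk s m. assert (Hn0 : (0 < n)%nat) by lia.
  assert (Hb : 0 <= 1 - d <= 1) by (split; lra).
  destruct (p_up_down_bounds n k (1 - d) Hn Hk Hb) as (Hu & Hdn & Hm).
  pose proof (mag_bound n k Hn0 Hk) as Hs. fold s in Hs.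
  pose proof (INR_inv_pos n Hn0) as Hh.
  unfold m. rewrite (markov_op_mag n (1 - d) (fun x => x * x)). fold s.
  pose proof (mag_mul_tanh (1 - d) s Hb Hs) as (Ht0 & Ht1 & Ht2).
  set (h := / INR n) in *. set (b := 1 - d) in *.
  set (u := p_up n b k) in *. set (dn := p_down n b k) in *.
  assert (HD : 4 * (s * (dn - u)) >= 2 * (s * s) - 2 * (s * tanh (b * s)) - 2 * h).
  { assert (Hbh : b * h <= h) by nra.
    assert (H1 : tanh (b * (s + h)) - tanh (b * s) <= b * (s + h) - b * s)
      by (apply tanh_lipschitz; nra).
    assert (H2 : tanh (b * s) - tanh (b * (s - h)) <= b * s - b * (s - h))
      by (apply tanh_lipschitz; nra).
    assert (H3 : tanh (b * (s - h)) <= tanh (b * s)) by (apply tanh_incr; nra).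
    assert (H4 : tanh (b * s) <= tanh (b * (s + h))) by (apply tanh_incr; nra).
    assert (E : 4 * (s * (dn - u)) = 2 * (s * s)
      - s * (tanh (b * (s - h)) + tanh (b * (s + h)))
      + s * s * (tanh (b * (s + h)) - tanh (b * (s - h)))).
    { unfold dn, u, p_down, p_up. fold s h. field. }
    rewrite E.
    assert (H5 : 0 <= s * s * (tanh (b * (s + h)) - tanh (b * (s - h)))).
    { apply Rmult_le_pos; [nra | lra]. }
    assert (H6 : s * (tanh (b * (s - h)) - tanh (b * s)) <= h) by nra.
    assert (H7 : s * (tanh (b * (s + h)) - tanh (b * s)) <= h) by nra.
    lra. }
  replace (u * ((s + 2 * h) * (s + 2 * h)) + dn * ((s - 2 * h) * (s - 2 * h))
    + (1 - dn - u) * (s * s))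
    with (s * s - h * (4 * (s * (dn - u))) + 4 * (h * h) * (dn + u)) by ring.
  assert (H8 : 4 * (h * h) * (dn + u) <= 4 * (h * h)) by nra.
  assert (H9 : h * (4 * (s * (dn - u)))
    >= h * (2 * (s * s) - 2 * (s * tanh (b * s)) - 2 * h))
    by (apply Rle_ge, Rmult_le_compat_l; lra).
  assert (H10 : h * (s * tanh (b * s)) <= h * (b * (s * s)))
    by (apply Rmult_le_compat_l; lra).
  assert (H11 : h * (s * tanh (b * s)) <= h * (s * s - s ^ 4 / 9))
    by (apply Rmult_le_compat_l; lra).
  unfold b in *. split; nra.
Qed.

(* The cubic part of the drift brings the second moment down from [1] like [n / t],
   irrespective of [d]; Jensen's inequality is used in the linearised form
   [E X^2 >= 2 v E X - v^2]. *)
Lemma second_moment_decay (n : nat) (d : R) (t k : nat) :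
  (8 <= n)%nat -> 0 < d <= 1 -> (k <= n)%nat ->
  markov_iter n (1 - d) t (fun j => mag n j * mag n j) k
  <= 9 / 2 * (INR n / (INR t + INR n)) + 6 / sqrt (INR n).
Proof.
  intros Hn Hd Hk. pose proof (INR_ge_8 n Hn) as HN.
  assert (Hb : 0 <= 1 - d <= 1) by (split; lra).
  set (N := INR n) in *.
  set (q := 6 / sqrt N).
  assert (HsN : sqrt N * sqrt N = N) by (apply sqrt_sqrt; lra).
  assert (HsN1 : 1 <= sqrt N).
  { rewrite <- sqrt_1. apply sqrt_le_1; lra. }
  assert (Hq : 0 <= q <= 6).
  { unfold q. split; [apply Rdiv_le_0_compat; lra |].
    apply Rmult_le_reg_r with (sqrt N); [lra |]. field_simplify; lra. }
  assert (Hqq : q * q = 36 * / N).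
  { unfold q. rewrite <- HsN at 3. field. lra. }
  induction t as [| t IH].
  - simpl. pose proof (mag_bound n k ltac:(lia) Hk).
    replace (N / (0 + N)) with 1 by (field; lra). nra.
  - rewrite markov_iter_S. pose proof (pos_INR t) as Ht.
    set (p := 9 / 2 * (N / (INR t + N))) in *.
    assert (Hp : 0 <= p <= 9 / 2).
    { unfold p. assert (0 <= N / (INR t + N) <= 1); [| lra].
      split; [apply Rdiv_le_0_compat; lra |].
      apply Rmult_le_reg_r with (INR t + N); [lra |]. field_simplify; lra. }
    (* Linearisation at the induction bound itself. The part [p] majorizes the noiseless recursion
       [p - 2/9 p^2 / n]; [q = 6 / sqrt n] is large enough for its gain [2/9 q^2 / n = 8 / n^2] to
       absorb the noise [6 / n^2]. *)
    set (v := p + q) in *.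
    set (A := 1 - 4 / 9 * / N * v).
    set (B := 2 / 9 * / N * (v * v) + 6 * (/ N * / N)).
    assert (HiN : 0 < / N <= / 8).
    { split; [apply Rinv_0_lt_compat; lra | apply Rinv_le_contravar; lra]. }
    assert (HA : 0 <= A) by (unfold A, v; nra).
    eapply Rle_trans.
    + apply (markov_iter_le n (1 - d) t _
        (fun j => A * (mag n j * mag n j) + 0 * 0 + B)); auto; [lia |].
      intros j Hj.
      destruct (second_moment_step n j d Hn Hd Hj) as [_ H]. cbv zeta in H.
      eapply Rle_trans; [apply H |]. fold N. unfold A, B.
      set (x := mag n j * mag n j).
      replace (mag n j ^ 4) with (x * x) by (unfold x; ring).
      assert (0 <= / N * ((x - v) * (x - v))) by (apply Rmult_le_pos; [lra | apply Rle_0_sqr]).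
      assert (E : (1 - 4 / 9 * / N * v) * x + 0 * 0
                  + (2 / 9 * / N * (v * v) + 6 * (/ N * / N))
                = x - 2 / 9 * / N * (x * x) + 6 * (/ N * / N)
                  + 2 / 9 * (/ N * ((x - v) * (x - v)))) by (field; lra).
      lra.
    + rewrite (markov_iter_lin n (1 - d) A 0 B t _ (fun _ => 0)).
      assert (Hv : A * markov_iter n (1 - d) t (fun j => mag n j * mag n j) k <= A * v)
        by (apply Rmult_le_compat_l; auto).
      assert (Hpp : p - 2 / 9 * / N * (p * p) <= 9 / 2 * (N / (INR (S t) + N))).
      { rewrite S_INR. unfold p. set (T := INR t) in *.
        assert (E : 9 / 2 * (N / (T + 1 + N)) - (9 / 2 * (N / (T + N))
            - 2 / 9 * / N * (9 / 2 * (N / (T + N)) * (9 / 2 * (N / (T + N)))))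
          = 9 / 2 * N * (/ ((T + N) * (T + N) * (T + 1 + N)))) by (field; lra).
        assert (0 <= 9 / 2 * N * (/ ((T + N) * (T + N) * (T + 1 + N)))).
        { apply Rmult_le_pos; [lra |]. left. apply Rinv_0_lt_compat.
          apply Rmult_lt_0_compat; nra. }
        lra. }
      assert (Hrest : A * v + B <= p - 2 / 9 * / N * (p * p) + q).
      { unfold A, B, v.
        assert (0 <= / N * (p * q)) by (apply Rmult_le_pos; nra).
        assert (0 <= / N * / N) by nra.
        assert (/ N * (q * q) = 36 * (/ N * / N)) by (rewrite Hqq; ring).
        replace ((1 - 4 / 9 * / N * (p + q)) * (p + q)
          + (2 / 9 * / N * ((p + q) * (p + q)) + 6 * (/ N * / N)))
          with (p + q - 2 / 9 * / N * (p * p) - 4 / 9 * (/ N * (p * q))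
                - 2 / 9 * (/ N * (q * q)) + 6 * (/ N * / N)) by (field; lra).
        lra. }
      lra.
Qed.

(** * Marginal laws and stationarity *)

Lemma sum_f_R0_single (n a : nat) (c : R) :
  (a <= n)%nat -> sum_f_R0 (fun j => if Nat.eqb j a then c else 0) n = c.
Proof.
  intro Ha. induction n as [| n IH]; simpl.
  - replace a with 0%nat by lia. reflexivity.
  - destruct (Nat.eq_dec a (S n)) as [-> | Hne].
    + rewrite Nat.eqb_refl, (sum_eq _ (fun _ => 0)).
      * rewrite sum_cte. ring.
      * intros i Hi. destruct (Nat.eqb_spec i (S n)); [lia | reflexivity].
    + rewrite IH by lia. destruct a; [ring |].
      destruct (Nat.eqb_spec n a); [lia | ring].
Qed.

Lemma sum_f_R0_0 (n : nat) (f : nat -> R) :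
  (forall i, (i <= n)%nat -> f i = 0) -> sum_f_R0 f n = 0.
Proof. intro H. rewrite (sum_eq _ (fun _ => 0)) by exact H. rewrite sum_cte. ring. Qed.

Lemma sum_P_mag (n : nat) (b : R) (f : nat -> R) (i : nat) :
  (0 < n)%nat -> (i <= n)%nat ->
  sum_f_R0 (fun j => P_mag n b i j * f j) n = markov_op n b f i.
Proof.
  intros Hn Hi. unfold P_mag, markov_op.
  rewrite (sum_eq _ (fun j =>
    (if Nat.eqb j (pred i) then p_down n b i * f (pred i) else 0)
    + (if Nat.eqb j (S i) then p_up n b i * f (S i) else 0)
    + (if Nat.eqb j i then (1 - p_down n b i - p_up n b i) * f i else 0))).
  - rewrite !sum_plus, (sum_f_R0_single n (pred i)), (sum_f_R0_single n i) by lia.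
    destruct (Nat.eq_dec i n) as [-> | Hne].
    + rewrite sum_f_R0_0.
      * rewrite p_up_n by auto. ring.
      * intros j Hj. destruct (Nat.eqb_spec j (S n)); [lia | reflexivity].
    + rewrite (sum_f_R0_single n (S i)) by lia. ring.
  - intros j Hj.
    destruct i as [| i].
    + simpl pred. rewrite p_down_0. simpl Nat.eqb.
      destruct (Nat.eqb_spec j 0) as [-> | H0]; simpl;
        [ring | destruct (Nat.eqb_spec j 1) as [-> | H1]; simpl; ring].
    + simpl pred. change (Nat.eqb (S j) (S i)) with (Nat.eqb j i).
      destruct (Nat.eqb_spec j i) as [H0 | H0], (Nat.eqb_spec j (S (S i))) as [H1 | H1],
        (Nat.eqb_spec j (S i)) as [H2 | H2]; try lia; subst; ring.
Qed.

(** Duality: evolving the law forward is adjoint to applying [markov_op], so the estimates can be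
    made on test functions. *)
Lemma sum_dist_t (n : nat) (b : R) (k0 t : nat) (f : nat -> R) :
  (0 < n)%nat -> (k0 <= n)%nat ->
  sum_f_R0 (fun j => dist_t n b k0 t j * f j) n = markov_iter n b t f k0.
Proof.
  intros Hn Hk. revert f. induction t as [| t IH]; intro f.
  - simpl. rewrite (sum_eq _ (fun j => if Nat.eqb j k0 then f k0 else 0)).
    + now apply sum_f_R0_single.
    + intros j _. destruct (Nat.eqb_spec j k0); subst; ring.
  - rewrite markov_iter_S, <- IH. simpl dist_t.
    rewrite (sum_eq _ (fun j => sum_f_R0 (fun i => dist_t n b k0 t i * (P_mag n b i j * f j)) n)).
    + rewrite <- !sum_n_Reals.
      rewrite (sum_n_ext _ (fun j => sum_n (fun i => dist_t n b k0 t i * (P_mag n b i j * f j)) n))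
        by (intro; now rewrite sum_n_Reals).
      rewrite sum_n_switch, !sum_n_Reals. apply sum_eq. intros i Hi.
      rewrite sum_n_Reals, <- sum_P_mag by auto.
      rewrite scal_sum. apply sum_eq. intros j _. ring.
    + intros j _. rewrite Rmult_comm, scal_sum. apply sum_eq. intros i _. ring.
Qed.

(** * The law of the magnetization under the Ising measure, and its reversibility *)

Definition plus_count (sigma : list bool) : nat := count_occ Bool.bool_dec sigma true.

Definition level (n k : nat) : list (list bool) :=
  filter (fun sigma => Nat.eqb (plus_count sigma) k) (configs n).

Lemma configs_length (n : nat) (sigma : list bool) :
  In sigma (configs n) -> length sigma = n.
Proof.
  revert sigma. induction n as [| n IH]; simpl; intros sigma H.
  - destruct H as [<- | []]. reflexivity.
  - apply in_app_or in H. destruct H as [H | H]; apply in_map_iff in H;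
      destruct H as [tau [<- H]]; simpl; now rewrite (IH tau H).
Qed.

Lemma plus_count_le (sigma : list bool) : (plus_count sigma <= length sigma)%nat.
Proof. apply count_occ_bound. Qed.

Lemma sum_spins (sigma : list bool) :
  sum_list (map spin sigma) = 2 * INR (plus_count sigma) - INR (length sigma).
Proof.
  induction sigma as [| s sigma IH]; simpl sum_list; [simpl; ring |].
  rewrite IH. unfold plus_count. simpl length. rewrite S_INR.
  destruct s; simpl count_occ; [rewrite S_INR |]; simpl; ring.
Qed.

(** Every spin squares to 1, so the squared total spin is [n] plus twice the pair sum; the Ising
    weight thus depends only on the number of plus spins. *)
Lemma pair_sum_eq (sigma : list bool) :
  pair_sum sigma
  = ((2 * INR (plus_count sigma) - INR (length sigma)) ^ 2 - INR (length sigma)) / 2.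
Proof.
  induction sigma as [| s sigma IH]; [simpl; field |].
  simpl pair_sum. rewrite IH, sum_spins. unfold plus_count. simpl length. rewrite S_INR.
  destruct s; simpl count_occ; [rewrite S_INR |]; simpl spin; field.
Qed.

Definition level_weight (n : nat) (b : R) (k : nat) : R :=
  exp (b / INR n * (((2 * INR k - INR n) ^ 2 - INR n) / 2)).

Lemma pi_n_eq (n : nat) (b : R) (k : nat) :
  pi_n n b k = INR (length (level n k)) * (level_weight n b k / partition_fn n b).
Proof.
  unfold pi_n. change (filter _ (configs n)) with (level n k).
  assert (H : forall sigma, In sigma (level n k) ->
     mu n b sigma = level_weight n b k / partition_fn n b).
  { intros sigma Hs. apply filter_In in Hs. destruct Hs as [Hs Hc].
    apply Nat.eqb_eq in Hc. unfold mu, ising_weight, level_weight.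
    now rewrite pair_sum_eq, Hc, (configs_length n sigma Hs). }
  induction (level n k) as [| s l IH]; [simpl; ring |].
  simpl map. simpl sum_list. rewrite IH by (intros; apply H; now right).
  rewrite (H s) by now left. simpl length. rewrite S_INR. ring.
Qed.

Lemma filter_length_map_cons (x : bool) (l : list (list bool)) (k : nat) :
  length (filter (fun s => Nat.eqb (plus_count s) k) (map (cons x) l))
  = length (filter (fun s => Nat.eqb (if x then S (plus_count s) else plus_count s) k) l).
Proof.
  induction l as [| s l IH]; [reflexivity |]. simpl.
  unfold plus_count in *. destruct x; simpl count_occ;
    match goal with |- context [if ?c then _ else _] => destruct c end; simpl; now rewrite IH.
Qed.

Lemma level_length_S (n k : nat) :
  length (level (S n) (S k)) = (length (level n k) + length (level n (S k)))%nat.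
Proof.
  unfold level. simpl configs.
  rewrite filter_app, length_app, !filter_length_map_cons. reflexivity.
Qed.

Lemma level_length_0 (n : nat) : length (level (S n) 0) = length (level n 0).
Proof.
  unfold level. simpl configs. rewrite filter_app, length_app, !filter_length_map_cons.
  replace (filter _ (configs n)) with (@nil (list bool)); [reflexivity |].
  symmetry. induction (configs n); auto.
Qed.

(** The level sizes are the binomial coefficients; the ratio of consecutive ones follows from
    Pascal's rule by induction on [n]. *)
Lemma level_length_ratio (n k : nat) :
  INR (length (level n k)) * (INR n - INR k) = INR (length (level n (S k))) * (INR k + 1).
Proof.
  revert k. induction n as [| n IH]; intro k.
  - destruct k; simpl; ring.
  - rewrite level_length_S, plus_INR, (S_INR n). destruct k as [| k].
    + rewrite level_length_0. specialize (IH 0%nat). simpl INR in *. lra.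
    + rewrite level_length_S, plus_INR. pose proof (IH k) as H1. pose proof (IH (S k)) as H2.
      rewrite !S_INR in *. lra.
Qed.

Lemma partition_fn_pos (n : nat) (b : R) : 0 < partition_fn n b.
Proof.
  unfold partition_fn. assert (H : configs n <> []).
  { induction n as [| n IH]; simpl; [discriminate |].
    destruct (configs n); [congruence | discriminate]. }
  destruct (configs n) as [| s l]; [congruence |]. clear H. simpl.
  assert (0 <= sum_list (map (ising_weight n b) l)).
  { induction l as [| s' l IH]; simpl; [lra |].
    pose proof (exp_pos (b / INR n * pair_sum s')). unfold ising_weight at 1. lra. }
  pose proof (exp_pos (b / INR n * pair_sum s)). unfold ising_weight at 1. lra.
Qed.

Lemma pi_n_nonneg (n : nat) (b : R) (k : nat) : 0 <= pi_n n b k.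
Proof.
  rewrite pi_n_eq. apply Rmult_le_pos; [apply pos_INR |].
  left. apply Rdiv_lt_0_compat; [apply exp_pos | apply partition_fn_pos].
Qed.

Lemma sum_filter_partition (n : nat) (g : list bool -> R) (l : list (list bool)) :
  (forall s, In s l -> (plus_count s <= n)%nat) ->
  sum_f_R0 (fun k => sum_list (map g (filter (fun s => Nat.eqb (plus_count s) k) l))) n
  = sum_list (map g l).
Proof.
  induction l as [| s l IH]; intro H.
  - now apply sum_f_R0_0.
  - simpl map. simpl sum_list. rewrite <- IH by (intros; apply H; now right).
    rewrite <- (sum_f_R0_single n (plus_count s) (g s)) by (apply H; now left).
    rewrite <- sum_plus. apply sum_eq. intros k _. simpl filter.
    rewrite Nat.eqb_sym. destruct (Nat.eqb (plus_count s) k) eqn:E;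
      rewrite Nat.eqb_sym, E; simpl; ring.
Qed.

Lemma pi_n_sum (n : nat) (b : R) : sum_f_R0 (pi_n n b) n = 1.
Proof.
  change (sum_f_R0 (fun k => sum_list (map (mu n b)
    (filter (fun s => Nat.eqb (plus_count s) k) (configs n)))) n = 1).
  rewrite (sum_filter_partition n (mu n b) (configs n)).
  - pose proof (partition_fn_pos n b) as Hz.
    assert (H : forall l, sum_list (map (mu n b) l)
      = sum_list (map (ising_weight n b) l) / partition_fn n b).
    { induction l as [| s l IH]; simpl; [field; lra |].
      rewrite IH. unfold mu. field. lra. }
    rewrite H. change (sum_list (map (ising_weight n b) (configs n))) with (partition_fn n b).
    field. lra.
  - intros s Hs. rewrite <- (configs_length n s Hs). apply plus_count_le.
Qed.

(** The odds of the two heat-bath outcomes form a Boltzmann factor. *)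
Lemma tanh_exp (x : R) : (1 + tanh x) = exp (2 * x) * (1 - tanh x).
Proof.
  assert (H : exp x * exp (- x) = 1) by (rewrite <- exp_plus, Rplus_opp_r; apply exp_0).
  pose proof (cosh_pos x) as Hc.
  replace (exp (2 * x)) with (exp x * exp x) by (rewrite <- exp_plus; f_equal; ring).
  apply Rmult_eq_reg_r with (cosh x); [| lra]. unfold tanh.
  replace ((1 + sinh x / cosh x) * cosh x) with (cosh x + sinh x) by (field; lra).
  replace (exp x * exp x * (1 - sinh x / cosh x) * cosh x)
    with (exp x * exp x * (cosh x - sinh x)) by (field; lra).
  unfold cosh, sinh. replace ((exp x + exp (- x)) / 2 + (exp x - exp (- x)) / 2) with (exp x) by field.
  replace ((exp x + exp (- x)) / 2 - (exp x - exp (- x)) / 2) with (exp (- x)) by field.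
  rewrite Rmult_assoc, H. ring.
Qed.

(** Both rates involve tanh at the same point [b (s + 1/n)]. The ratio of level sizes cancels the
    vertex-choice factors, and the ratio of weights [exp (2 b (s + 1/n))] is cancelled through
    [tanh_exp]. *)
Lemma detailed_balance (n k : nat) (b : R) :
  (0 < n)%nat -> pi_n n b k * p_up n b k = pi_n n b (S k) * p_down n b (S k).
Proof.
  intro Hn. rewrite !pi_n_eq. pose proof (level_length_ratio n k) as Hr.
  unfold p_up, p_down. rewrite mag_S.
  replace (mag n k + 2 * / INR n - / INR n) with (mag n k + / INR n) by ring.
  rewrite tanh_exp. set (T := tanh (b * (mag n k + / INR n))).
  assert (HN : INR n <> 0) by (apply not_0_INR; lia).
  assert (Hw : level_weight n b (S k)
    = level_weight n b k * exp (2 * (b * (mag n k + / INR n)))).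
  { unfold level_weight. rewrite <- exp_plus. f_equal. rewrite S_INR. unfold mag. field. auto. }
  rewrite Hw. set (w := level_weight n b k). set (E := exp _).
  pose proof (partition_fn_pos n b) as Hz. set (Z := partition_fn n b) in *.
  replace ((1 - mag n k) / 2) with ((INR n - INR k) / INR n) by (unfold mag; field; auto).
  replace ((1 + (mag n k + 2 * / INR n)) / 2) with ((INR k + 1) / INR n)
    by (unfold mag; field; auto).
  set (N1 := INR (length (level n k))) in *. set (N2 := INR (length (level n (S k)))) in *.
  replace (N1 * (w / Z) * ((INR n - INR k) / INR n * (E * (1 - T) / 2)))
    with (N1 * (INR n - INR k) * (w / Z * E * (1 - T) / 2 / INR n)) by (field; split; lra).
  rewrite Hr. field. split; lra.
Qed.

(** Summed up to level [m], everything cancels by detailed balance except the flux across the edge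
    from [m] to [m + 1], and no flux leaves [n]. *)
Lemma sum_pi_n_markov_op (n : nat) (b : R) (f : nat -> R) :
  (0 < n)%nat ->
  sum_f_R0 (fun k => pi_n n b k * markov_op n b f k) n
  = sum_f_R0 (fun k => pi_n n b k * f k) n.
Proof.
  intro Hn.
  assert (H : forall m, (m <= n)%nat ->
    sum_f_R0 (fun k => pi_n n b k * markov_op n b f k) m
    = sum_f_R0 (fun k => pi_n n b k * f k) m
      + pi_n n b m * p_up n b m * (f (S m) - f m)).
  { induction m as [| m IH]; intro Hm.
    - simpl. unfold markov_op. rewrite p_down_0. simpl pred. ring.
    - rewrite !tech5, IH by lia. rewrite detailed_balance by auto.
      unfold markov_op. simpl pred. ring. }
  rewrite H by auto. rewrite p_up_n by auto. ring.
Qed.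

Lemma sum_pi_n_markov_iter (n : nat) (b : R) (t : nat) (f : nat -> R) :
  (0 < n)%nat ->
  sum_f_R0 (fun k => pi_n n b k * markov_iter n b t f k) n
  = sum_f_R0 (fun k => pi_n n b k * f k) n.
Proof.
  intro Hn. induction t as [| t IH]; [reflexivity |].
  rewrite <- IH. apply (sum_pi_n_markov_op n b (markov_iter n b t f)). exact Hn.
Qed.

Lemma sum_weighted_between (n : nat) (w f : nat -> R) (a c : R) :
  (forall k, (k <= n)%nat -> 0 <= w k) -> sum_f_R0 w n = 1 ->
  (forall k, (k <= n)%nat -> a <= f k <= c) ->
  a <= sum_f_R0 (fun k => w k * f k) n <= c.
Proof.
  intros Hw Hs Hf. split.
  - replace a with (a * sum_f_R0 w n) by (rewrite Hs; ring).
    rewrite scal_sum. apply sum_Rle. intros k Hk.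
    specialize (Hw k Hk). specialize (Hf k Hk). nra.
  - replace c with (c * sum_f_R0 w n) by (rewrite Hs; ring).
    rewrite scal_sum. apply sum_Rle. intros k Hk.
    specialize (Hw k Hk). specialize (Hf k Hk). nra.
Qed.

(** By stationarity [V] is also the mean of the updated [s^2], so [V <= (1 - 2 d / n) V + 6 / n^2];
    solve for [V]. *)
Lemma pi_n_second_moment (n : nat) (d : R) :
  (8 <= n)%nat -> 0 < d <= 1 ->
  sum_f_R0 (fun k => pi_n n (1 - d) k * (mag n k * mag n k)) n <= 3 / (d * INR n).
Proof.
  intros Hn Hd. pose proof (INR_ge_8 n Hn) as HN.
  set (V := sum_f_R0 (fun k => pi_n n (1 - d) k * (mag n k * mag n k)) n).
  assert (H : V <= (1 - 2 * d * / INR n) * V + 6 * (/ INR n * / INR n)).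
  { unfold V at 1. rewrite <- (sum_pi_n_markov_op n (1 - d)) by lia.
    set (c := 6 * (/ INR n * / INR n)).
    replace c with (c * sum_f_R0 (pi_n n (1 - d)) n) by (rewrite pi_n_sum; ring).
    unfold V. rewrite !scal_sum, <- sum_plus. apply sum_Rle. intros k Hk.
    destruct (second_moment_step n k d Hn Hd Hk) as [Hs _]. cbv zeta in Hs.
    pose proof (pi_n_nonneg n (1 - d) k).
    replace (pi_n n (1 - d) k * (mag n k * mag n k) * (1 - 2 * d * / INR n)
      + pi_n n (1 - d) k * c) with
      (pi_n n (1 - d) k * ((1 - 2 * d * / INR n) * (mag n k * mag n k) + c)) by ring.
    now apply Rmult_le_compat_l. }
  assert (Hdn : 0 < d * INR n) by nra.
  apply Rmult_le_reg_r with (2 * d * / INR n).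
  - apply Rmult_lt_0_compat; [lra |]. apply Rinv_0_lt_compat. lra.
  - replace (3 / (d * INR n) * (2 * d * / INR n)) with (6 * (/ INR n * / INR n)) by (field; lra).
    lra.
Qed.

(** * Upper bound *)

(** Half the sign of the difference of the two laws is extremal; its values of size 1/2 match the
    normalisation in [smoothing]. *)
Lemma tv_dist_attained (n : nat) (b : R) (k0 t : nat) :
  (0 < n)%nat -> (k0 <= n)%nat ->
  exists f : nat -> R, (forall k, (k <= n)%nat -> Rabs (f k) <= / 2) /\
    tv_dist n b k0 t = markov_iter n b t f k0 - sum_f_R0 (fun k => pi_n n b k * f k) n.
Proof.
  intros Hn Hk.
  exists (fun j => if Rle_dec 0 (dist_t n b k0 t j - pi_n n b j) then / 2 else - / 2).
  split.
  - intros k _. destruct Rle_dec; apply Rabs_le; lra.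
  - rewrite <- sum_dist_t by auto. unfold tv_dist. rewrite scal_sum, <- minus_sum.
    apply sum_eq. intros j _. destruct Rle_dec as [H | H].
    + rewrite Rabs_right by lra. ring.
    + rewrite Rabs_left by lra. ring.
Qed.

Lemma tv_dist_ge (n : nat) (b : R) (k0 t : nat) (f : nat -> R) :
  (0 < n)%nat -> (k0 <= n)%nat -> (forall k, (k <= n)%nat -> Rabs (f k) <= / 2) ->
  markov_iter n b t f k0 - sum_f_R0 (fun k => pi_n n b k * f k) n <= tv_dist n b k0 t.
Proof.
  intros Hn Hk Hf. rewrite <- sum_dist_t by auto.
  unfold tv_dist. rewrite scal_sum, <- minus_sum. apply sum_Rle. intros j Hj.
  rewrite <- Rmult_minus_distr_r. eapply Rle_trans; [apply Rle_abs |].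
  rewrite Rabs_mult. apply Rmult_le_compat_l; [apply Rabs_pos | auto].
Qed.

Lemma d_n_le (n : nat) (b : R) (t : nat) (B : R) :
  0 <= B -> (forall k0, (k0 <= n)%nat -> tv_dist n b k0 t <= B) -> d_n n b t <= B.
Proof.
  intros HB H. unfold d_n.
  assert (Hin : forall k, In k (seq 0 (S n)) -> tv_dist n b k t <= B).
  { intros k Hk. apply in_seq in Hk. apply H. lia. }
  clear H. induction (seq 0 (S n)) as [| k l IH]; cbn [map fold_right]; [exact HB |].
  apply Rmax_lub; [apply Hin; now left |]. apply IH. intros; apply Hin; now right.
Qed.

Lemma d_n_ge (n : nat) (b : R) (t k0 : nat) :
  (k0 <= n)%nat -> tv_dist n b k0 t <= d_n n b t.
Proof.
  intro H. unfold d_n. assert (Hin : In k0 (seq 0 (S n))) by (apply in_seq; lia).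
  induction (seq 0 (S n)) as [| k l IH]; [destruct Hin |].
  cbn [map fold_right]. destruct Hin as [-> | Hin].
  - apply Rmax_l.
  - eapply Rle_trans; [now apply IH | apply Rmax_r].
Qed.

Lemma d_n_nonneg (n : nat) (b : R) (t : nat) : 0 <= d_n n b t.
Proof.
  unfold d_n. induction (seq 0 (S n)) as [| k l IH]; cbn [map fold_right]; [lra |].
  eapply Rle_trans; [exact IH | apply Rmax_r].
Qed.

Lemma nat_floor_spec (x : R) :
  0 <= x -> INR (Z.to_nat (Int_part x)) <= x < INR (Z.to_nat (Int_part x)) + 1.
Proof.
  intro Hx. destruct (base_Int_part x) as [H1 H2].
  assert (0 <= Int_part x)%Z.
  { assert (-1 < Int_part x)%Z; [| lia]. apply lt_IZR. lra. }
  rewrite INR_IZR_INZ, Z2Nat.id by auto. lra.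
Qed.

Lemma exp_INR_mult (x : R) (t : nat) : exp (INR t * x) = exp x ^ t.
Proof.
  induction t as [| t IH]; [simpl; rewrite Rmult_0_l; apply exp_0 |].
  rewrite S_INR, Rmult_plus_distr_r, exp_plus, IH, Rmult_1_l. simpl. ring.
Qed.

(** With the last [tau + r] steps absorbed, the test function [h] is [l]-Lipschitz, hence within
    [l |k - n/2|], up to rounding, of its central value [c]; the second moment after the first [T1]
    steps controls that distance. The free parameter [v] weights the two terms of AM-GM. *)
Lemma tv_dist_upper (n : nat) (d v phi : R) (T1 tau r k0 : nat) :
  (8 <= n)%nat -> 0 < d <= 1 -> (4 <= r)%nat -> (k0 <= n)%nat -> 0 < v ->
  9 / 2 * (INR n / (INR T1 + INR n)) + 6 / sqrt (INR n) <= phi ->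
  tv_dist n (1 - d) k0 (T1 + (tau + r))
  <= 2 * ((1 - d / INR n) ^ tau * (405 / sqrt (INR r)))
       * (INR n / 4 * (phi / v + v) + 1).
Proof.
  intros Hn Hd Hr Hk Hv Hphi.
  assert (Hn0 : (0 < n)%nat) by lia. assert (Hb : 0 <= 1 - d <= 1) by (split; lra).
  pose proof (INR_ge_8 n Hn) as HN.
  destruct (tv_dist_attained n (1 - d) k0 (T1 + (tau + r)) Hn0 Hk) as (f & Hf & ->).
  (* Stationarity writes the second term as an average of the same iterate, so one bound uniform in
     the starting state handles both terms and costs a factor 2. *)
  rewrite <- (sum_pi_n_markov_iter n (1 - d) (T1 + (tau + r))) by auto.
  set (h := markov_iter n (1 - d) (tau + r) f).
  set (l := (1 - d / INR n) ^ tau * (405 / sqrt (INR r))).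
  assert (Hlip : lip n l h).
  { unfold h. rewrite markov_iter_add. apply lip_markov_iter; auto.
    apply smoothing; auto. }
  assert (Hl : 0 <= l) by (eapply Rle_trans; [apply Rabs_pos | apply (Hlip 0%nat); lia]).
  (* [Nat.div2 n] stands for zero magnetization; for odd [n] no such state exists, which accounts
     for the additional 1. *)
  set (c := h (Nat.div2 n)).
  assert (Hhalf : Rabs (INR (Nat.div2 n) - INR n / 2) <= 1).
  { pose proof (Nat.div2_odd n) as Ho. apply (f_equal INR) in Ho.
    rewrite plus_INR, mult_INR in Ho. apply Rabs_le.
    destruct (Nat.odd n); simpl in Ho; lra. }
  assert (Hpt : forall k, (k <= n)%nat ->
    Rabs (h k - c) <= l * (INR n / 4 * / v) * (mag n k * mag n k)
                      + (l * (INR n / 4 * v) + l)).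
  { intros k Hkn.
    assert (H1 : Rabs (h k - c) <= l * Rabs (INR k - INR (Nat.div2 n))).
    { assert (Hdn : (Nat.div2 n <= n)%nat)
        by (rewrite Nat.div2_div; apply Nat.Div0.div_le_upper_bound; lia).
      unfold c. destruct (Nat.le_ge_cases k (Nat.div2 n)) as [Hle | Hle].
      - rewrite Rabs_minus_sym, (Rabs_minus_sym (INR k)).
        rewrite (Rabs_right (INR _ - INR k)) by (apply le_INR in Hle; lra).
        apply (lip_dist n l h Hlip). lia.
      - rewrite (Rabs_right (INR k - _)) by (apply le_INR in Hle; lra).
        apply (lip_dist n l h Hlip). lia. }
    assert (H2 : Rabs (INR k - INR (Nat.div2 n)) <= INR n / 2 * Rabs (mag n k) + 1).
    { replace (INR k - INR (Nat.div2 n))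
        with (INR n / 2 * mag n k + - (INR (Nat.div2 n) - INR n / 2))
        by (unfold mag; field; lra).
      eapply Rle_trans; [apply Rabs_triang |]. rewrite Rabs_Ropp, Rabs_mult.
      rewrite (Rabs_right (INR n / 2)) by lra. lra. }
    (* AM-GM: [2 |s| <= s^2 / v + v] *)
    assert (H3 : 2 * Rabs (mag n k) <= / v * (mag n k * mag n k) + v).
    { assert (E : / v * (mag n k * mag n k) + v - 2 * Rabs (mag n k)
        = / v * ((Rabs (mag n k) - v) * (Rabs (mag n k) - v))).
      { replace (mag n k * mag n k) with (Rabs (mag n k) * Rabs (mag n k))
          by (rewrite <- Rabs_mult; apply Rabs_right, Rle_ge, Rle_0_sqr).
        field. lra. }
      assert (0 <= / v * ((Rabs (mag n k) - v) * (Rabs (mag n k) - v))).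
      { apply Rmult_le_pos; [left; now apply Rinv_0_lt_compat | apply Rle_0_sqr]. }
      lra. }
    eapply Rle_trans; [apply H1 |].
    replace (l * (INR n / 4 * / v) * (mag n k * mag n k) + (l * (INR n / 4 * v) + l))
      with (l * (INR n / 4 * (/ v * (mag n k * mag n k) + v) + 1)) by (field; lra).
    apply Rmult_le_compat_l; auto. nra. }
  set (B := l * (INR n / 4 * (phi / v + v) + 1)).
  assert (HiterB : forall k, (k <= n)%nat ->
    c - B <= markov_iter n (1 - d) (T1 + (tau + r)) f k <= c + B).
  { intros k Hkn. rewrite markov_iter_add. fold h.
    set (A := l * (INR n / 4 * / v)). set (e := l * (INR n / 4 * v) + l).
    assert (Hiv : 0 < / v) by now apply Rinv_0_lt_compat.
    assert (HA : 0 <= A) by (unfold A; apply Rmult_le_pos; nra).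
    pose proof (second_moment_decay n d T1 k Hn Hd Hkn) as Hm.
    set (M := markov_iter n (1 - d) T1 (fun j => mag n j * mag n j) k) in *.
    assert (HAM : A * M <= A * phi) by (apply Rmult_le_compat_l; lra).
    assert (HB : A * phi + e = B) by (unfold A, e, B; field; lra).
    split.
    - apply Rle_trans with (markov_iter n (1 - d) T1
        (fun j => (- A) * (mag n j * mag n j) + 0 * 0 + (c - e)) k).
      + rewrite (markov_iter_lin n (1 - d) (- A) 0 (c - e) T1 _ (fun _ => 0)). fold M. lra.
      + apply markov_iter_le; auto; [lia |]. intros j Hj. specialize (Hpt j Hj).
        apply Rabs_le_between in Hpt. fold A e in Hpt. lra.
    - apply Rle_trans with (markov_iter n (1 - d) T1
        (fun j => A * (mag n j * mag n j) + 0 * 0 + (c + e)) k).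
      + apply markov_iter_le; auto; [lia |]. intros j Hj. specialize (Hpt j Hj).
        apply Rabs_le_between in Hpt. fold A e in Hpt. lra.
      + rewrite (markov_iter_lin n (1 - d) A 0 (c + e) T1 _ (fun _ => 0)). fold M. lra. }
  pose proof (sum_weighted_between n (pi_n n (1 - d)) _ (c - B) (c + B)
    (fun k _ => pi_n_nonneg n (1 - d) k) (pi_n_sum n (1 - d)) HiterB) as Hpi.
  pose proof (HiterB k0 Hk) as H0.
  replace (2 * l * (INR n / 4 * (phi / v + v) + 1)) with (2 * B) by (unfold B; ring).
  lra.
Qed.

Lemma exp_monotone (x y : R) : x <= y -> exp x <= exp y.
Proof. intros [H | ->]; [left; now apply exp_increasing | lra]. Qed.

Lemma exp_half_ln (d N : R) :
  0 < d -> 0 < N -> exp (- (/ 2 * ln (d ^ 2 * N))) = / (d * sqrt N).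
Proof.
  intros Hd HN. pose proof (sqrt_lt_R0 N HN) as Hs.
  replace (d ^ 2 * N) with ((d * sqrt N) * (d * sqrt N)).
  - rewrite ln_mult by nra.
    replace (- (/ 2 * (ln (d * sqrt N) + ln (d * sqrt N)))) with (- ln (d * sqrt N)) by field.
    rewrite exp_Ropp, exp_ln by nra. reflexivity.
  - replace (d * sqrt N * (d * sqrt N)) with (d ^ 2 * (sqrt N * sqrt N)) by ring.
    rewrite sqrt_sqrt by lra. reflexivity.
Qed.

Lemma sqrt_scaling_facts (d N : R) :
  0 < d <= 1 -> 14 <= d ^ 2 * N ->
  0 < N /\ sqrt d * sqrt d = d /\ sqrt N * sqrt N = N /\ 0 < sqrt d <= 1 /\
  d <= sqrt d /\ 1 <= d * sqrt N /\ 0 < sqrt N.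
Proof.
  intros Hd HN.
  assert (HN0 : 0 < N) by nra.
  pose proof (sqrt_sqrt d ltac:(lra)) as Hda. pose proof (sqrt_sqrt N ltac:(lra)) as HsN.
  pose proof (sqrt_lt_R0 d ltac:(lra)) as Ha. pose proof (sqrt_lt_R0 N HN0) as Hs.
  assert (Ha1 : sqrt d <= 1) by (rewrite <- sqrt_1; apply sqrt_le_1; lra).
  repeat split; auto; [nra |].
  assert (0 < d * sqrt N) by nra.
  assert (1 <= (d * sqrt N) * (d * sqrt N)).
  { replace (d * sqrt N * (d * sqrt N)) with (d ^ 2 * (sqrt N * sqrt N)) by ring.
    rewrite HsN. lra. }
  nra.
Qed.

Lemma d_n_real_upper (n : nat) (d g : R) :
  (8 <= n)%nat -> 0 < d <= 1 -> 14 <= d ^ 2 * INR n -> 2 <= g ->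
  d_n_real n (1 - d) (/ 2 * (INR n / d) * ln (d ^ 2 * INR n) + g * (INR n / d))
  <= 6480 * exp (3 - g).
Proof.
  intros Hn Hd HdN Hg. pose proof (INR_ge_8 n Hn) as HN.
  destruct (sqrt_scaling_facts d (INR n) Hd HdN) as (_ & Hda & HsN & Ha & Hdle & Hds & Hs).
  set (N := INR n) in *. set (a := sqrt d) in *. set (sN := sqrt N) in *.
  set (L := ln (d ^ 2 * N)).
  assert (HL : 0 <= L).
  { unfold L. rewrite <- ln_1. apply ln_le; lra. }
  set (T := / 2 * (N / d) * L + g * (N / d)).
  assert (HNd : N <= N / d).
  { apply Rmult_le_reg_r with d; [lra |]. field_simplify; nra. }
  assert (HT : 2 * (N / d) <= T).
  { unfold T. assert (0 <= / 2 * (N / d) * L) by (apply Rmult_le_pos; lra).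
    assert (2 * (N / d) <= g * (N / d)) by (apply Rmult_le_compat_r; lra). lra. }
  unfold d_n_real.
  destruct (nat_floor_spec T ltac:(lra)) as [Ht1 Ht2].
  set (t := Z.to_nat (Int_part T)) in *.
  destruct (nat_floor_spec (N / d) ltac:(lra)) as [Hm1 Hm2].
  set (m := Z.to_nat (Int_part (N / d))) in *.
  assert (Hmt : (2 * m <= t)%nat).
  { assert (INR (2 * m) < INR (S t)); [| apply INR_lt in H; lia].
    rewrite S_INR, mult_INR. simpl (INR 2). lra. }
  assert (Hm4 : (4 <= m)%nat).
  { assert (INR 4 < INR (S m)); [| apply INR_lt in H; lia]. rewrite (S_INR m). simpl (INR 4). lra. }
  (* Both outer stretches have [m] steps, the integer part of [n / d]; [tau] is what remains for the
     contraction. *)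
  set (tau := (t - 2 * m)%nat).
  replace t with (m + (tau + m))%nat by (unfold tau; lia).
  set (q := (1 - d / N) ^ tau).
  assert (Hq0 : 0 <= q).
  { apply pow_le. pose proof (contraction_range n d ltac:(lia) Hd). fold N in H. lra. }
  (* The 3 in the exponent is 2 for the two outer stretches and [d / n <= 1] for rounding down the
     time. *)
  assert (Hq : q <= exp (3 - g) * / (d * sN)).
  { apply Rle_trans with (exp (INR tau * - (d / N))).
    - rewrite exp_INR_mult. apply pow_incr.
      pose proof (contraction_range n d ltac:(lia) Hd) as Hc. fold N in Hc.
      pose proof (exp_ineq1_le (- (d / N))). lra.
    - unfold sN. rewrite <- exp_half_ln, <- exp_plus by lra. fold L. apply exp_monotone.
      assert (Htau : T - 1 - 2 * (N / d) <= INR tau).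
      { unfold tau. rewrite minus_INR, mult_INR by auto. simpl (INR 2). lra. }
      assert (Hx : 0 < d / N <= 1).
      { split; [apply Rdiv_lt_0_compat; lra |].
        apply Rmult_le_reg_r with N; [lra |]. field_simplify; lra. }
      assert (H : (T - 1 - 2 * (N / d)) * (d / N) <= INR tau * (d / N))
        by (apply Rmult_le_compat_r; lra).
      replace ((T - 1 - 2 * (N / d)) * (d / N)) with (/ 2 * L + g - d / N - 2) in H
        by (unfold T; field; lra).
      lra. }
  (* [m > n/d - 1] is at least [n / (4 d)], whose square root is the quotient on the left. *)
  assert (Hsm : sN / (2 * a) <= sqrt (INR m)).
  { rewrite <- (sqrt_square (sN / (2 * a))).
    - apply sqrt_le_1.
      + apply Rle_0_sqr.
      + apply pos_INR.
      + replace (sN / (2 * a) * (sN / (2 * a))) with (N / d / 4).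
        * lra.
        * rewrite <- HsN, <- Hda. field. lra.
    - apply Rdiv_le_0_compat; lra. }
  assert (Hsa : 0 < sN / (2 * a)) by (apply Rdiv_lt_0_compat; lra).
  assert (Hl : 405 / sqrt (INR m) <= 810 * a / sN).
  { replace (810 * a / sN) with (405 / (sN / (2 * a))) by (field; lra).
    apply Rmult_le_compat_l; [lra |]. apply Rinv_le_contravar; lra. }
  (* [m + n >= n / d] turns the first term into [9/2 d], and [1 <= d sqrt n] turns the second into
     [6 d]. *)
  assert (Hphi : 9 / 2 * (N / (INR m + N)) + 6 / sN <= 21 / 2 * d).
  { assert (H1 : N / (INR m + N) <= d).
    { apply Rmult_le_reg_r with (INR m + N); [lra |].
      replace (N / (INR m + N) * (INR m + N)) with (d * (N / d)) by (field; lra).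
      apply Rmult_le_compat_l; lra. }
    assert (H2 : / sN <= d).
    { apply Rmult_le_reg_r with sN; [lra |]. rewrite Rinv_l by lra. lra. }
    unfold Rdiv at 3. lra. }
  apply d_n_le.
  - pose proof (exp_pos (3 - g)). lra.
  - intros k0 Hk0.
    (* The choice [v = sqrt d] balances [phi / v] against [v]. The final constant is
       [6480 = 2 * 810 * 4]. *)
    eapply Rle_trans;
      [apply (tv_dist_upper n d a (21 / 2 * d) m tau m k0 Hn Hd Hm4 Hk0 (proj1 Ha) Hphi) |].
    fold N q.
    replace (21 / 2 * d / a + a) with (23 / 2 * a) by (rewrite <- Hda; field; lra).
    assert (Hfac : N / 4 * (23 / 2 * a) + 1 <= 4 * N * a).
    { assert (1 <= N * a) by nra. nra. }
    apply Rle_trans with (2 * (exp (3 - g) * / (d * sN) * (810 * a / sN)) * (4 * N * a)).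
    + apply Rmult_le_compat.
      * apply Rmult_le_pos; [lra |]. apply Rmult_le_pos; [auto |].
        apply Rdiv_le_0_compat; lra.
      * nra.
      * apply Rmult_le_compat_l; [lra |]. apply Rmult_le_compat; auto.
        apply Rdiv_le_0_compat; lra.
      * exact Hfac.
    + right. rewrite <- HsN. rewrite <- Hda. field. lra.
Qed.

(** * Lower bound *)

Definition odd_fn (n : nat) (f : nat -> R) : Prop :=
  forall k, (k <= n)%nat -> f (n - k)%nat = - f k.

(** Global spin flip: replacing [k] by [n - k] exchanges the up and down probabilities. *)
Lemma odd_markov_op (n : nat) (b : R) (f : nat -> R) :
  (0 < n)%nat -> odd_fn n f -> odd_fn n (markov_op n b f).
Proof.
  intros Hn Hf k Hk. unfold markov_op.
  destruct (p_symm n k b Hn Hk) as [-> ->]. rewrite (Hf k Hk).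
  assert (H1 : p_down n b k * f (S (n - k)) = - (p_down n b k * f (pred k))).
  { destruct k as [| k]; [rewrite p_down_0; ring |].
    replace (S (n - S k)) with (n - k)%nat by lia. simpl pred. rewrite Hf by lia. ring. }
  assert (H2 : p_up n b k * f (pred (n - k)) = - (p_up n b k * f (S k))).
  { destruct (Nat.eq_dec k n) as [-> | Hkn]; [rewrite p_up_n by auto; ring |].
    replace (pred (n - k)) with (n - S k)%nat by lia. rewrite Hf by lia. ring. }
  rewrite H1, H2. ring.
Qed.

Lemma odd_markov_iter (n : nat) (b : R) (t : nat) (f : nat -> R) :
  (0 < n)%nat -> odd_fn n f -> odd_fn n (markov_iter n b t f).
Proof.
  intros Hn Hf. induction t as [| t IH]; [exact Hf |]. now apply odd_markov_op.
Qed.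

Lemma odd_fn_center (n k : nat) (f : nat -> R) : odd_fn n f -> (2 * k = n)%nat -> f k = 0.
Proof.
  intros Hf Hk. specialize (Hf k ltac:(lia)). replace (n - k)%nat with k in Hf by lia. lra.
Qed.

Lemma mag_half (n k : nat) : (0 < n)%nat -> (n < 2 * k)%nat -> / INR n <= mag n k.
Proof.
  intros Hn Hk. assert (HN : 0 < INR n) by now apply lt_0_INR.
  assert (H : INR n + 1 <= 2 * INR k).
  { replace 2 with (INR 2) by (simpl; ring). rewrite <- mult_INR, <- S_INR. apply le_INR. lia. }
  replace (mag n k) with (/ INR n * (2 * INR k - INR n)) by (unfold mag; field; lra).
  rewrite <- (Rmult_1_r (/ INR n)) at 1. apply Rmult_le_compat_l; [| lra].
  left. now apply Rinv_0_lt_compat.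
Qed.

(* Just above the center the chain may jump to the mirror image; the mass so lost
   is at most the mass that stays. *)
Lemma markov_op_odd_nonneg (n : nat) (b : R) (f : nat -> R) :
  (8 <= n)%nat -> 0 <= b <= 1 -> odd_fn n f ->
  (forall k, (k <= n)%nat -> (n <= 2 * k)%nat -> 0 <= f k) ->
  forall k, (k <= n)%nat -> (n <= 2 * k)%nat -> 0 <= markov_op n b f k.
Proof.
  intros Hn Hb Hodd Hf k Hk Hk2. assert (Hn0 : (0 < n)%nat) by lia.
  destruct (p_up_down_bounds n k b Hn Hk Hb) as (Hu & Hdn & Hm).
  pose proof (Hf k Hk Hk2) as Hfk.
  destruct (Nat.eq_dec (2 * k) n) as [Hc | Hc].
  { rewrite (odd_fn_center n k (markov_op n b f)); [lra | now apply odd_markov_op | exact Hc]. }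
  assert (Hup : 0 <= p_up n b k * f (S k)).
  { destruct (Nat.eq_dec k n) as [-> | Hkn]; [rewrite p_up_n by auto; lra |].
    apply Rmult_le_pos; auto. apply Hf; lia. }
  unfold markov_op. destruct (Nat.eq_dec (2 * k) (S n)) as [Hc1 | Hc1].
  - replace (pred k) with (n - k)%nat by lia. rewrite Hodd by auto.
    assert (Hdk : p_down n b k <= 5 / 16).
    { pose proof (INR_inv_le_8 n Hn). unfold p_down.
      assert (Hmag : mag n k = / INR n).
      { apply (f_equal INR) in Hc1. rewrite mult_INR, (S_INR n) in Hc1. simpl (INR 2) in Hc1.
        unfold mag. apply lt_0_INR in Hn0.
        replace (-1 + 2 * INR k / INR n) with ((2 * INR k - INR n) / INR n) by (field; lra).
        replace (2 * INR k - INR n) with 1 by lra. field. lra. }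
      rewrite Hmag. rewrite Rminus_diag, Rmult_0_r, tanh_0. lra. }
    assert (0 <= (1 - 2 * p_down n b k - p_up n b k) * f k) by (apply Rmult_le_pos; lra).
    lra.
  - assert (0 <= p_down n b k * f (pred k)) by (apply Rmult_le_pos; auto; apply Hf; lia).
    assert (0 <= (1 - p_down n b k - p_up n b k) * f k) by (apply Rmult_le_pos; lra).
    lra.
Qed.

Lemma markov_iter_odd_nonneg (n : nat) (b : R) (t : nat) (f : nat -> R) :
  (8 <= n)%nat -> 0 <= b <= 1 -> odd_fn n f ->
  (forall k, (k <= n)%nat -> (n <= 2 * k)%nat -> 0 <= f k) ->
  forall k, (k <= n)%nat -> (n <= 2 * k)%nat -> 0 <= markov_iter n b t f k.
Proof.
  intros Hn Hb Hodd Hf. induction t as [| t IH]; [exact Hf |].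
  apply (markov_op_odd_nonneg n b (markov_iter n b t f)); auto.
  apply odd_markov_iter; [lia | auto].
Qed.

(** Comparison principle: the iterate minus [lam^t f] is odd and nonnegative on the upper half, a
    cone that the operator preserves; one more step multiplies the lower bound by [lam]. *)
Lemma markov_iter_odd_ge (n : nat) (b lam : R) (t : nat) (f : nat -> R) :
  (8 <= n)%nat -> 0 <= b <= 1 -> 0 <= lam -> odd_fn n f ->
  (forall k, (k <= n)%nat -> (n <= 2 * k)%nat -> lam * f k <= markov_op n b f k) ->
  forall k, (k <= n)%nat -> (n <= 2 * k)%nat -> lam ^ t * f k <= markov_iter n b t f k.
Proof.
  intros Hn Hb Hlam Hodd Hf. induction t as [| t IH]; intros k Hk Hk2.
  - simpl. lra.
  - set (u := fun j => 1 * markov_iter n b t f j + (- lam ^ t) * f j + 0).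
    assert (Hu : 0 <= markov_op n b u k).
    { apply markov_op_odd_nonneg; auto.
      - intros j Hj. unfold u. pose proof (odd_markov_iter n b t f ltac:(lia) Hodd j Hj) as E1.
        pose proof (Hodd j Hj) as E2. rewrite E1, E2.
        ring.
      - intros j Hj Hj2. unfold u. specialize (IH j Hj Hj2). lra. }
    unfold u in Hu. rewrite (markov_op_lin n b 1 (- lam ^ t) 0) in Hu.
    change (markov_iter n b (S t) f k) with (markov_op n b (markov_iter n b t f) k).
    assert (lam ^ t * (lam * f k) <= lam ^ t * markov_op n b f k)
      by (apply Rmult_le_compat_l; [now apply pow_le | auto]).
    simpl. lra.
Qed.

(** For [s >= 1/n] both tanh arguments are nonnegative, so [tanh x] lies between [x - x^3/3] and
    [x]. In the sum of the two the shifts by [1/n] cancel to first order; the remainders are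
    collected in [2 s / n]. *)
Lemma drift_positive_side (n k : nat) (d : R) :
  (0 < n)%nat -> 0 < d <= 1 -> (k <= n)%nat -> / INR n <= mag n k ->
  let s := mag n k in let D := p_down n (1 - d) k - p_up n (1 - d) k in
  d * s <= 2 * D <= d * s + s ^ 3 / 3 + 2 * (/ INR n * s).
Proof.
  intros Hn Hd Hk Hs s D. pose proof (mag_bound n k Hn Hk) as Hs1. fold s in Hs, Hs1.
  pose proof (INR_inv_pos n Hn) as Hh. pose proof (INR_inv_le_1 n Hn) as Hh1.
  assert (E : 4 * D = 2 * s
      - (tanh ((1 - d) * (s - / INR n)) + tanh ((1 - d) * (s + / INR n)))
      + s * (tanh ((1 - d) * (s + / INR n)) - tanh ((1 - d) * (s - / INR n)))).
  { unfold D, p_down, p_up. fold s. field. }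
  set (h := / INR n) in *. set (b := 1 - d) in *.
  assert (Hb : 0 <= b <= 1) by (unfold b; lra).
  assert (A0 : 0 <= b * (s - h)) by (apply Rmult_le_pos; lra).
  assert (A1 : 0 <= b * (s + h)) by (apply Rmult_le_pos; lra).
  pose proof (tanh_le_id _ A0) as B0. pose proof (tanh_le_id _ A1) as B1.
  pose proof (tanh_ge_cubic _ A0) as C0. pose proof (tanh_ge_cubic _ A1) as C1.
  assert (Hmono : tanh (b * (s - h)) <= tanh (b * (s + h))) by (apply tanh_incr; nra).
  assert (Hlip : tanh (b * (s + h)) - tanh (b * (s - h)) <= b * (s + h) - b * (s - h))
    by (apply tanh_lipschitz; nra).
  assert (P0 : (b * (s - h)) ^ 3 <= (s - h) ^ 3) by (apply pow_incr; nra).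
  assert (P1 : (b * (s + h)) ^ 3 <= (s + h) ^ 3) by (apply pow_incr; nra).
  assert (Q0 : 0 <= s * (tanh (b * (s + h)) - tanh (b * (s - h)))) by (apply Rmult_le_pos; lra).
  assert (Q1 : s * (tanh (b * (s + h)) - tanh (b * (s - h))) <= s * (2 * h))
    by (apply Rmult_le_compat_l; nra).
  assert (R0 : (s - h) ^ 3 + (s + h) ^ 3 = 2 * s ^ 3 + 6 * (s * (h * h))) by ring.
  assert (R1 : s * (h * h) <= s * h) by (apply Rmult_le_compat_l; nra).
  replace (b * (s - h)) with (s - d * s - b * h) in * by (unfold b; ring).
  replace (b * (s + h)) with (s - d * s + b * h) in * by (unfold b; ring).
  split; lra.
Qed.

(* In continuous time the cubic [s - s^3 / d] is a subsolution of the drift equation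
   [s' = - d s - s^3 / 3]; the term [14 / (d n)] pays for the noise. *)
Lemma cubic_subsolution (n k : nat) (d : R) :
  (8 <= n)%nat -> 0 < d <= 1 -> 14 <= d ^ 2 * INR n -> (k <= n)%nat -> (n <= 2 * k)%nat ->
  (1 - (d + 14 / (d * INR n)) / INR n) * (mag n k - mag n k ^ 3 / d)
  <= markov_op n (1 - d) (fun j => mag n j - mag n j ^ 3 / d) k.
Proof.
  intros Hn Hd HdN Hk Hk2. assert (Hn0 : (0 < n)%nat) by lia.
  pose proof (INR_ge_8 n Hn) as HN.
  assert (Hb : 0 <= 1 - d <= 1) by (split; lra).
  destruct (Nat.eq_dec (2 * k) n) as [Hc | Hc].
  { rewrite (odd_fn_center n k (markov_op n (1 - d) (fun j => mag n j - mag n j ^ 3 / d))); auto.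
    - replace (mag n k) with 0; [right; field; lra |].
      symmetry. apply (odd_fn_center n k (mag n)); auto. intros j Hj. now apply mag_symm.
    - apply odd_markov_op; auto. intros j Hj. rewrite mag_symm by auto. field. lra. }
  pose proof (mag_half n k Hn0 ltac:(lia)) as Hs.
  destruct (drift_positive_side n k d Hn0 Hd Hk Hs) as [HD1 HD2].
  destruct (p_up_down_bounds n k (1 - d) Hn Hk Hb) as (Hu & Hdn & Hm).
  rewrite (markov_op_mag n (1 - d) (fun x => x - x ^ 3 / d)).
  set (s := mag n k) in *. set (u := p_up n (1 - d) k) in *. set (dn := p_down n (1 - d) k) in *.
  unfold Rdiv. rewrite Rinv_mult.
  assert (Hhi : 14 * (/ INR n * (/ d * / d)) <= 1).
  { apply Rmult_le_reg_r with (d ^ 2 * INR n); [lra |]. field_simplify; lra. }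
  pose proof (INR_inv_pos n Hn0) as Hh.
  assert (Hi : 1 <= / d) by (rewrite <- Rinv_1; apply Rinv_le_contravar; lra).
  assert (Hdi : d * / d = 1) by (field; lra).
  set (h := / INR n) in *. set (i := / d) in *.
  set (D := dn - u) in *. set (m := dn + u) in *.
  replace (u * (s + 2 * h - (s + 2 * h) ^ 3 * i) + dn * (s - 2 * h - (s - 2 * h) ^ 3 * i)
    + (1 - dn - u) * (s - s ^ 3 * i))
    with (s - s ^ 3 * i - h * (2 * D) + 3 * (i * h * (s * s)) * (2 * D)
          - 12 * (i * (h * h) * s) * m + 4 * (i * (h * h * h)) * (2 * D))
    by (unfold D, m; ring).
  assert (Hs0 : 0 < s) by lra.
  assert (Hish : 0 <= i * h * (s * s)) by (apply Rmult_le_pos; [nra | nra]).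
  assert (Hihs : 0 <= i * (h * h) * s) by (apply Rmult_le_pos; [apply Rmult_le_pos; nra | lra]).
  assert (Hihh : 0 <= i * (h * h * h)) by (apply Rmult_le_pos; [lra | apply Rmult_le_pos; nra]).
  (* Budget beyond [h d s]: the drift loses at most [h s^3 / 3] and [2 h^2 s], the second-order term
     gains at least [3 h s^3], the third-order one costs at most [12 i h^2 s]. The net [3 - 1/3]
     covers the two copies of [h s^3] in the target, one of them through [14 h i^2 <= 1], and
     [2 + 12 = 14]. *)
  assert (T1 : h * (2 * D) <= h * (d * s + s ^ 3 * / 3 + 2 * (h * s)))
    by (apply Rmult_le_compat_l; lra).
  assert (T2 : i * h * (s * s) * (d * s) <= i * h * (s * s) * (2 * D))
    by (apply Rmult_le_compat_l; lra).
  assert (T3 : i * (h * h) * s * m <= i * (h * h) * s * 1)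
    by (apply Rmult_le_compat_l; lra).
  assert (T4 : 0 <= i * (h * h * h) * (2 * D)) by (apply Rmult_le_pos; nra).
  replace (i * h * (s * s) * (d * s)) with (h * s ^ 3) in T2
    by (replace (i * h * (s * s) * (d * s)) with ((d * i) * (h * s ^ 3)) by ring;
        rewrite Hdi; ring).
  replace ((1 - (d + 14 * (i * h)) * h) * (s - s ^ 3 * i))
    with (s - s ^ 3 * i - h * (d * s) + d * i * (h * s ^ 3) - 14 * (i * (h * h) * s)
          + 14 * (h * (i * i)) * (h * s ^ 3)) by ring.
  rewrite Hdi.
  assert (Hhs3 : 0 <= h * s ^ 3) by (apply Rmult_le_pos; [lra | apply pow_le; lra]).
  assert (T5 : 14 * (h * (i * i)) * (h * s ^ 3) <= 1 * (h * s ^ 3))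
    by (apply Rmult_le_compat_r; lra).
  assert (T6 : h * (h * s) <= i * (h * h) * s).
  { replace (h * (h * s)) with (1 * (h * h * s)) by ring.
    replace (i * (h * h) * s) with (i * (h * h * s)) by ring.
    apply Rmult_le_compat_r; [| lra]. apply Rmult_le_pos; nra. }
  nra.
Qed.

(** Chebyshev's inequality at the threshold halfway between 0 and the mean [M] of [s]. The errors
    come from the variance bound [4 / (d n)] and the stationary second moment [3 / (d n)];
    [28 = 4 (4 + 3)]. *)
Lemma tv_dist_lower (n : nat) (d : R) (t k0 : nat) :
  (8 <= n)%nat -> 0 < d <= 1 -> (k0 <= n)%nat ->
  0 < markov_iter n (1 - d) t (mag n) k0 ->
  1 - 28 / (d * INR n * (markov_iter n (1 - d) t (mag n) k0
                         * markov_iter n (1 - d) t (mag n) k0))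
  <= tv_dist n (1 - d) k0 t.
Proof.
  intros Hn Hd Hk HM. pose proof (INR_ge_8 n Hn) as HN.
  assert (Hb : 0 <= 1 - d <= 1) by (split; lra).
  set (M := markov_iter n (1 - d) t (mag n) k0) in *.
  set (f := fun j => if Rle_dec (M / 2) (mag n j) then / 2 else - / 2).
  assert (Hlip : lip n (2 * / INR n) (mag n)).
  { intros j Hj. rewrite mag_S. pose proof (INR_inv_pos n ltac:(lia)).
    rewrite Rabs_right; lra. }
  pose proof (variance_iter n d (2 * / INR n) (mag n) t k0 ltac:(lia) Hd Hlip Hk) as Hvar.
  fold M in Hvar.
  set (S2 := markov_iter n (1 - d) t (fun j => mag n j * mag n j) k0) in *.
  assert (Hvar' : S2 - M * M <= 4 / (d * INR n)).
  { eapply Rle_trans; [apply Hvar |].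
    pose proof (contraction_range n d ltac:(lia) Hd) as Hc.
    assert (0 <= (1 - d / INR n) ^ t) by (apply pow_le; lra).
    replace (2 * / INR n * (2 * / INR n) * (INR n / d)) with (4 / (d * INR n)) by (field; lra).
    rewrite <- (Rmult_1_r (4 / (d * INR n))) at 2. apply Rmult_le_compat_l; [| lra].
    apply Rdiv_le_0_compat; nra. }
  pose proof (tv_dist_ge n (1 - d) k0 t f ltac:(lia) Hk) as Htv.
  eapply Rle_trans; [| apply Htv].
  2: { intros j _. unfold f. destruct Rle_dec; apply Rabs_le; lra. }
  (* Since [c (M/2)^2 = 1], the step function [f] is bounded below by [1/2 - c (M - s)^2] and above
     by [-1/2 + c s^2]. *)
  set (c := 4 * / (M * M)).
  assert (HMM : 0 < M * M) by nra.
  assert (Hc : 0 < c) by (unfold c; pose proof (Rinv_0_lt_compat _ HMM); lra).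
  assert (HcM : c * ((M / 2) * (M / 2)) = 1) by (unfold c; field; lra).
  assert (H1 : / 2 - c * (4 / (d * INR n)) <= markov_iter n (1 - d) t f k0).
  { apply Rle_trans with (markov_iter n (1 - d) t
      (fun j => (- c) * (mag n j * mag n j) + (2 * c * M) * mag n j + (/ 2 - c * (M * M))) k0).
    - rewrite markov_iter_lin. fold M S2.
      assert (c * (S2 - M * M) <= c * (4 / (d * INR n))) by (apply Rmult_le_compat_l; lra).
      lra.
    - apply markov_iter_le; auto; [lia |]. intros j Hj. unfold f.
      replace (- c * (mag n j * mag n j) + 2 * c * M * mag n j + (/ 2 - c * (M * M)))
        with (/ 2 - c * ((M - mag n j) * (M - mag n j))) by ring.
      destruct Rle_dec as [Hle | Hlt].
      + assert (0 <= c * ((M - mag n j) * (M - mag n j)))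
          by (apply Rmult_le_pos; [lra | apply Rle_0_sqr]). lra.
      + assert (c * ((M / 2) * (M / 2)) <= c * ((M - mag n j) * (M - mag n j)))
          by (apply Rmult_le_compat_l; [lra | apply Rmult_le_compat; lra]). lra. }
  assert (H2 : sum_f_R0 (fun k => pi_n n (1 - d) k * f k) n <= - / 2 + c * (3 / (d * INR n))).
  { pose proof (pi_n_second_moment n d Hn Hd) as Hpi.
    apply Rle_trans with (- / 2 * sum_f_R0 (pi_n n (1 - d)) n
      + c * sum_f_R0 (fun k => pi_n n (1 - d) k * (mag n k * mag n k)) n).
    - rewrite !scal_sum, <- sum_plus. apply sum_Rle. intros j Hj.
      pose proof (pi_n_nonneg n (1 - d) j) as Hp.
      replace (pi_n n (1 - d) j * - / 2 + pi_n n (1 - d) j * (mag n j * mag n j) * c)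
        with (pi_n n (1 - d) j * (- / 2 + c * (mag n j * mag n j))) by ring.
      apply Rmult_le_compat_l; auto. unfold f. destruct Rle_dec as [Hle | Hlt].
      + assert (c * ((M / 2) * (M / 2)) <= c * (mag n j * mag n j))
          by (apply Rmult_le_compat_l; [lra | apply Rmult_le_compat; lra]). lra.
      + assert (0 <= c * (mag n j * mag n j))
          by (apply Rmult_le_pos; [lra | apply Rle_0_sqr]). lra.
    - rewrite pi_n_sum. assert (c * sum_f_R0 (fun k => pi_n n (1 - d) k * (mag n k * mag n k)) n
        <= c * (3 / (d * INR n))) by (apply Rmult_le_compat_l; lra). lra. }
  replace (1 - 28 / (d * INR n * (M * M)))
    with (/ 2 - c * (4 / (d * INR n)) - (- / 2 + c * (3 / (d * INR n))))
    by (unfold c; field; lra).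
  lra.
Qed.

(** Rests on [(1 - x) (1 + x + 2 x^2) >= 1], valid for [0 <= x <= 1/2]. *)
Lemma pow_ge_exp (x : R) (t : nat) :
  0 <= x <= / 2 -> exp (- (INR t * (x + 2 * (x * x)))) <= (1 - x) ^ t.
Proof.
  intros Hx. replace (- (INR t * (x + 2 * (x * x)))) with (INR t * - (x + 2 * (x * x))) by ring.
  rewrite exp_INR_mult. apply pow_incr. split; [left; apply exp_pos |].
  assert (H : / (1 - x) <= exp (x + 2 * (x * x))).
  { apply Rle_trans with (1 + (x + 2 * (x * x))); [| apply exp_ineq1_le].
    apply Rmult_le_reg_r with (1 - x); [lra |]. rewrite Rinv_l by lra. nra. }
  rewrite exp_Ropp. rewrite <- (Rinv_inv (1 - x)). apply Rinv_le_contravar; auto.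
  apply Rinv_0_lt_compat. lra.
Qed.

(** Rounding the target magnetization [a / 2] down to a state loses at most [2 / n <= a / 4]. *)
Lemma start_state (n : nat) (a : R) :
  0 <= a <= 1 -> 0 < INR n -> 8 <= INR n * a ->
  exists k0, (k0 <= n)%nat /\ (n <= 2 * k0)%nat /\ a / 4 <= mag n k0 <= a / 2.
Proof.
  intros Ha HN HNa. destruct (nat_floor_spec (INR n * (1 + a / 2) / 2)) as [H1 H2].
  { apply Rdiv_le_0_compat; [apply Rmult_le_pos; lra | lra]. }
  set (k0 := Z.to_nat _) in *. exists k0.
  assert (Hk1 : INR k0 <= INR n) by nra.
  assert (Hk2 : INR n <= 2 * INR k0) by lra.
  split; [now apply INR_le |]. split.
  - apply INR_le. rewrite mult_INR. simpl (INR 2). lra.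
  - unfold mag. split; apply Rmult_le_reg_r with (INR n); auto.
    + replace ((-1 + 2 * INR k0 / INR n) * INR n) with (2 * INR k0 - INR n) by (field; lra). lra.
    + replace ((-1 + 2 * INR k0 / INR n) * INR n) with (2 * INR k0 - INR n) by (field; lra). lra.
Qed.

Lemma ln_le_sub_1 (x : R) : 0 < x -> ln x <= x - 1.
Proof.
  intro Hx. pose proof (exp_ineq1_le (ln x)) as H. rewrite exp_ln in H by auto. lra.
Qed.

Lemma d_n_real_lower (n : nat) (d g : R) :
  (8 <= n)%nat -> 0 < d <= 1 -> 14 <= d ^ 2 * INR n -> 0 <= g ->
  2 * g <= ln (d ^ 2 * INR n) ->
  1 - 800 * exp (22 - 2 * g)
  <= d_n_real n (1 - d) (/ 2 * (INR n / d) * ln (d ^ 2 * INR n) - g * (INR n / d)).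
Proof.
  intros Hn Hd HdN Hg HgL. pose proof (INR_ge_8 n Hn) as HN.
  assert (Hb : 0 <= 1 - d <= 1) by (split; lra).
  destruct (sqrt_scaling_facts d (INR n) Hd HdN) as (_ & Hda & HsN & Ha & Hdle & Hds & Hs).
  pose proof (exp_half_ln d (INR n) ltac:(lra) ltac:(lra)) as HexpL.
  pose proof (ln_le_sub_1 (d ^ 2 * INR n) ltac:(lra)) as HLle.
  set (a := sqrt d) in *. set (sN := sqrt (INR n)) in *.
  set (L := ln (d ^ 2 * INR n)) in *.
  assert (HNa : 8 <= INR n * a) by nra.
  destruct (start_state n a ltac:(lra) ltac:(lra) HNa) as (k0 & Hk & Hk2 & Hmag).
  set (T := / 2 * (INR n / d) * L - g * (INR n / d)).
  assert (HNd : 0 < INR n / d) by (apply Rdiv_lt_0_compat; lra).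
  assert (HT : T = INR n / d * (/ 2 * L - g)) by (unfold T; ring).
  (* The hypothesis [2 g <= L] makes [T] nonnegative, so [t] is its true integer part rather than
     the default 0. *)
  unfold d_n_real. destruct (nat_floor_spec T) as [Ht1 _].
  { rewrite HT. apply Rmult_le_pos; lra. }
  set (t := Z.to_nat (Int_part T)) in *.
  eapply Rle_trans; [| apply (d_n_ge n (1 - d) t k0 Hk)].
  set (x := (d + 14 / (d * INR n)) / INR n).
  assert (H14 : 14 / (d * INR n) <= d).
  { apply Rmult_le_reg_r with (d * INR n); [nra |]. field_simplify; nra. }
  assert (H14p : 0 < 14 / (d * INR n)) by (apply Rdiv_lt_0_compat; nra).
  assert (Hx : 0 < x <= 2 * d / INR n).
  { unfold x. split; [apply Rdiv_lt_0_compat; lra |].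
    apply Rmult_le_compat_r; [left; apply Rinv_0_lt_compat; lra | lra]. }
  assert (Hx2 : 2 * d / INR n <= / 4).
  { apply Rmult_le_reg_r with (INR n); [lra |]. field_simplify; lra. }
  set (lam := 1 - x).
  (* The exponent is [L/2 - g] plus two corrections, at most 7 from the noise term in [x] and at
     most 4 from [2 x^2], both by [L <= d^2 n]; hence the 11. *)
  assert (Hlam : exp (g - 11) * / (d * sN) <= lam ^ t).
  { apply Rle_trans with (exp (- (INR t * (x + 2 * (x * x))))).
    - rewrite <- HexpL, <- exp_plus. apply exp_monotone.
      assert (Hxx : x + 2 * (x * x) <= d / INR n + 14 / (d * INR n) / INR n
                                       + 8 * (d / INR n * (d / INR n))).
      { assert (x * x <= 2 * d / INR n * (2 * d / INR n)) by (apply Rmult_le_compat; lra).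
        replace x with (d / INR n + 14 / (d * INR n) / INR n) at 1 by (unfold x; field; lra).
        unfold Rdiv in *. nra. }
      assert (Hpos : 0 <= x + 2 * (x * x)) by nra.
      assert (Htx : INR t * (x + 2 * (x * x)) <= T * (x + 2 * (x * x)))
        by (apply Rmult_le_compat_r; auto).
      assert (HTx : T * (x + 2 * (x * x)) <= T * (d / INR n + 14 / (d * INR n) / INR n
                                       + 8 * (d / INR n * (d / INR n)))).
      { apply Rmult_le_compat_l; auto. rewrite HT. apply Rmult_le_pos; lra. }
      replace (T * (d / INR n + 14 / (d * INR n) / INR n + 8 * (d / INR n * (d / INR n))))
        with ((/ 2 * L - g) + (/ 2 * L - g) * (14 / (d ^ 2 * INR n))
              + (/ 2 * L - g) * (8 * d * / INR n)) in HTx by (rewrite HT; field; lra).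
      assert (E1 : (/ 2 * L - g) * (14 / (d ^ 2 * INR n)) <= 7).
      { assert (Hw : 0 < 14 / (d ^ 2 * INR n)) by (apply Rdiv_lt_0_compat; lra).
        apply Rle_trans with (/ 2 * (d ^ 2 * INR n) * (14 / (d ^ 2 * INR n))).
        - apply Rmult_le_compat_r; lra.
        - right. field. lra. }
      assert (E2 : (/ 2 * L - g) * (8 * d * / INR n) <= 4).
      { assert (Hw : 0 < 8 * d * / INR n)
          by (apply Rmult_lt_0_compat; [lra | apply Rinv_0_lt_compat; lra]).
        apply Rle_trans with (/ 2 * (d ^ 2 * INR n) * (8 * d * / INR n)).
        - apply Rmult_le_compat_r; lra.
        - replace (/ 2 * (d ^ 2 * INR n) * (8 * d * / INR n)) with (4 * d ^ 3) by (field; lra).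
          assert (d ^ 3 <= 1 ^ 3) by (apply pow_incr; lra). lra. }
      lra.
    - apply pow_ge_exp. lra. }
  set (h := fun j => mag n j - mag n j ^ 3 / d).
  assert (Hodd3 : odd_fn n (fun j => mag n j ^ 3 / d)).
  { intros j Hj. rewrite mag_symm by (auto; lia). field. lra. }
  assert (Hoddh : odd_fn n h).
  { intros j Hj. unfold h. rewrite mag_symm by (auto; lia). field. lra. }
  pose proof (markov_iter_odd_ge n (1 - d) lam t h Hn Hb ltac:(unfold lam; lra) Hoddh
    (fun k Hk Hk2 => cubic_subsolution n k d Hn Hd HdN Hk Hk2) k0 Hk Hk2) as Hge.
  (* The cube is odd and nonnegative on the upper half, so its expectation may be dropped: the mean
     of [s] is at least that of [h]. *)
  assert (Hcube : 0 <= markov_iter n (1 - d) t (fun j => mag n j ^ 3 / d) k0).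
  { apply markov_iter_odd_nonneg; auto. intros j Hj Hj2.
    assert (Hm0 : 0 <= mag n j).
    { destruct (Nat.eq_dec (2 * j) n) as [Hc | Hc].
      - rewrite (odd_fn_center n j (mag n)); [lra | | exact Hc].
        intros i Hi. apply mag_symm; [lia | auto].
      - pose proof (mag_half n j ltac:(lia) ltac:(lia)).
        pose proof (INR_inv_pos n ltac:(lia)). lra. }
    apply Rdiv_le_0_compat; [now apply pow_le | lra]. }
  assert (Hsplit : markov_iter n (1 - d) t h k0 = markov_iter n (1 - d) t (mag n) k0
    - markov_iter n (1 - d) t (fun j => mag n j ^ 3 / d) k0).
  { transitivity (markov_iter n (1 - d) t
      (fun j => 1 * mag n j + (-1) * (mag n j ^ 3 / d) + 0) k0).
    - apply Rle_antisym; apply markov_iter_le; auto; try lia; intros j _; unfold h; lra.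
    - rewrite (markov_iter_lin n (1 - d) 1 (-1) 0 t). ring. }
  set (M := markov_iter n (1 - d) t (mag n) k0) in *.
  (* [s <= a/2] makes the cubic term at most a quarter of [s], and [s >= a/4]; the product of 3/4
     and 1/4 is 3/16. *)
  assert (Hh0 : 3 / 16 * a <= h k0).
  { unfold h. set (s := mag n k0) in *.
    assert (Hsd : s ^ 3 / d <= s / 4).
    { apply Rmult_le_reg_r with d; [lra |].
      replace (s ^ 3 / d * d) with (s * (s * s)) by (field; lra).
      rewrite <- Hda. replace (s / 4 * (a * a)) with (s * (a / 2 * (a / 2))) by field.
      apply Rmult_le_compat_l; [lra |]. apply Rmult_le_compat; lra. }
    lra. }
  set (R0 := exp (g - 11) * / (d * sN) * (3 / 16 * a)).
  assert (HR0 : 0 < R0).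
  { unfold R0. apply Rmult_lt_0_compat; [| lra]. apply Rmult_lt_0_compat; [apply exp_pos |].
    apply Rinv_0_lt_compat. lra. }
  assert (HM : R0 <= M).
  { apply Rle_trans with (lam ^ t * h k0); [| lra].
    apply Rmult_le_compat; auto; [| lra].
    left. apply Rmult_lt_0_compat; [apply exp_pos | apply Rinv_0_lt_compat; lra]. }
  eapply Rle_trans; [| apply (tv_dist_lower n d t k0 Hn Hd Hk)]; fold M; [| lra].
  assert (HRM : R0 * R0 <= M * M) by (apply Rmult_le_compat; lra).
  assert (HdNp : 0 < d * INR n) by nra.
  assert (H28 : 28 / (d * INR n * (M * M)) <= 28 / (d * INR n * (R0 * R0))).
  { apply Rmult_le_compat_l; [lra |]. apply Rinv_le_contravar.
    - apply Rmult_lt_0_compat; [auto | nra].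
    - apply Rmult_le_compat_l; lra. }
  (* All powers of [d] and [n] cancel; [7168/9 = 28 (16/3)^2] is below 800. *)
  assert (Hval : 28 / (d * INR n * (R0 * R0)) = 7168 / 9 * exp (22 - 2 * g)).
  { replace (22 - 2 * g) with (- (g - 11) + - (g - 11)) by ring.
    rewrite exp_plus, exp_Ropp. unfold R0. rewrite <- HsN.
    pose proof (exp_pos (g - 11)).
    replace d with (a * a) by auto. field. repeat split; lra. }
  pose proof (exp_pos (22 - 2 * g)). lra.
Qed.

(** * Passage to the limits in [n] and [gamma] *)

Lemma LimSup_seq_between (u : nat -> R) (a b : R) :
  eventually (fun n => a <= u n <= b) ->
  Rbar_le a (LimSup_seq u) /\ Rbar_le (LimSup_seq u) b.
Proof.
  intros [N H]. split.
  - rewrite <- (LimSup_seq_const a). apply LimSup_le. exists N. intros n Hn. now apply H.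
  - rewrite <- (LimSup_seq_const b). apply LimSup_le. exists N. intros n Hn. now apply H.
Qed.

Lemma LimInf_seq_between (u : nat -> R) (a b : R) :
  eventually (fun n => a <= u n <= b) ->
  Rbar_le a (LimInf_seq u) /\ Rbar_le (LimInf_seq u) b.
Proof.
  intros [N H]. split.
  - rewrite <- (LimInf_seq_const a). apply LimInf_le. exists N. intros n Hn. now apply H.
  - rewrite <- (LimInf_seq_const b). apply LimInf_le. exists N. intros n Hn. now apply H.
Qed.

Lemma d_n_le_1 (n : nat) (b : R) (t : nat) :
  (8 <= n)%nat -> 0 <= b <= 1 -> d_n n b t <= 1.
Proof.
  intros Hn Hb. apply d_n_le; [lra |]. intros k0 Hk.
  destruct (tv_dist_attained n b k0 t ltac:(lia) Hk) as (f & Hf & ->).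
  pose proof (osc_markov_iter n b t f Hn Hb Hf k0 Hk) as H1.
  apply Rabs_le_between in H1.
  pose proof (sum_weighted_between n (pi_n n b) f (- / 2) (/ 2)
    (fun k _ => pi_n_nonneg n b k) (pi_n_sum n b)
    (fun k Hk => proj1 (Rabs_le_between _ _) (Hf k Hk))) as H2.
  lra.
Qed.

Lemma eventually_scaling (delta : nat -> R) (M : R) :
  is_lim_seq (fun n => delta n ^ 2 * INR n) p_infty ->
  eventually (fun n => (8 <= n)%nat /\ M <= delta n ^ 2 * INR n).
Proof.
  intro H. apply is_lim_seq_spec in H. destruct (H M) as [N HN].
  exists (Nat.max 8 N). intros n Hn. split; [lia |]. left. apply HN. lia.
Qed.

Theorem theorem4p1 :
  forall delta : nat -> R,
    (forall n : nat, 0 < delta n <= 1) ->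
    is_lim_seq (fun n => delta n ^ 2 * INR n) p_infty ->
    Rbar_lim_at_infty
      (fun gamma => LimSup_seq (fun n =>
         d_n_real n (1 - delta n)
           (/ 2 * (INR n / delta n) * ln (delta n ^ 2 * INR n) + gamma * (INR n / delta n))))
      0
    /\
    Rbar_lim_at_infty
      (fun gamma => LimInf_seq (fun n =>
         d_n_real n (1 - delta n)
           (/ 2 * (INR n / delta n) * ln (delta n ^ 2 * INR n) - gamma * (INR n / delta n))))
      1.
Proof.
  intros delta Hdelta Hlim. split; intros eps Heps.
  (* Beyond this threshold the bound [6480 exp (3 - g)] is at most [eps / 2], which leaves room for
     the strict inequality. *)
  - exists (Rmax 2 (3 - ln (eps / 2 / 6480))). intros g Hg.
    assert (Hg1 : 2 < g) by (eapply Rle_lt_trans; [apply Rmax_l | exact Hg]).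
    assert (Hg2 : 3 - ln (eps / 2 / 6480) < g) by (eapply Rle_lt_trans; [apply Rmax_r | exact Hg]).
    assert (He : exp (3 - g) <= eps / 2 / 6480).
    { rewrite <- (exp_ln (eps / 2 / 6480)) by lra. apply exp_monotone. lra. }
    match goal with |- Rbar_lt _ (LimSup_seq ?u) /\ _ =>
      destruct (LimSup_seq_between u 0 (eps / 2)) as [H1 H2] end.
    + destruct (eventually_scaling delta 14 Hlim) as [N HN]. exists N. intros n Hn.
      destruct (HN n Hn) as [Hn8 Hn14]. split; [apply d_n_nonneg |].
      eapply Rle_trans; [apply d_n_real_upper; auto; lra |]. lra.
    + split.
      * eapply Rbar_lt_le_trans; [| exact H1]. simpl. lra.
      * eapply Rbar_le_lt_trans; [exact H2 |]. simpl. lra.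
  - exists (Rmax 0 ((22 - ln (eps / 2 / 800)) / 2)). intros g Hg.
    assert (Hg1 : 0 < g) by (eapply Rle_lt_trans; [apply Rmax_l | exact Hg]).
    assert (Hg2 : (22 - ln (eps / 2 / 800)) / 2 < g)
      by (eapply Rle_lt_trans; [apply Rmax_r | exact Hg]).
    assert (He : exp (22 - 2 * g) <= eps / 2 / 800).
    { rewrite <- (exp_ln (eps / 2 / 800)) by lra. apply exp_monotone. lra. }
    match goal with |- Rbar_lt _ (LimInf_seq ?u) /\ _ =>
      destruct (LimInf_seq_between u (1 - eps / 2) 1) as [H1 H2] end.
    (* The entry [exp (2 g)] secures [2 g <= ln (delta^2 n)] for the fixed [g] once [n] is large. *)
    + destruct (eventually_scaling delta (Rmax 14 (exp (2 * g))) Hlim) as [N HN].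
      exists N. intros n Hn. destruct (HN n Hn) as [Hn8 HnM].
      pose proof (Rmax_l 14 (exp (2 * g))) as Hm1. pose proof (Rmax_r 14 (exp (2 * g))) as Hm2.
      specialize (Hdelta n). split.
      * eapply Rle_trans; [| apply d_n_real_lower; auto; try lra].
        -- lra.
        -- rewrite <- (ln_exp (2 * g)). apply ln_le; [apply exp_pos | lra].
      * apply d_n_le_1; auto. split; lra.
    + split.
      * eapply Rbar_lt_le_trans; [| exact H1]. simpl. lra.
      * eapply Rbar_le_lt_trans; [exact H2 |]. simpl. lra.
Qed.
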